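(* Let $X$ be a separable metric space and let $G$ be a topological subgroup of $\mathrm{Iso}(X)$. Then $G$ is amenable if and only if, for all $n\in\mathbb{N}$ and all $x\in X^{n}$, the action of $G$ on the orbit $Gx\subseteq X^n$ is Liouville.
   Context: For a metric space $X$, $\mathrm{Iso}(X)$ is the group of all isometric self-bijections of $X$ with the topology of pointwise convergence; it is a topological group. $X^n$ carries the supremum metric $d_{X^n}(x,y)=\sup_{1\le i\le n}d_X(x_i,y_i)$ and $G$ acts on $X^n$ by $gx=(gx_1,\dots,gx_n)$; $Gx=\{gx\mid g\in G\}$ carries the restricted metric. For a topological group $G$ and $g\in G$ let $\lambda_g(x)=gx$. A function $f\colon G\to\mathbb{C}$ is right-uniformly continuous if for every $\varepsilon>0$ there is a neighbourhood $U$ of the neutral element such that $|f(x)-f(y)|\le\varepsilon$ whenever $xy^{-1}\in U$; $\mathrm{RUCB}(G)$ is the $C^*$-algebra of all bounded such functions with supremum norm, and $\mathrm{M}(G)$ is the set of its states (positive linear functionals $\mu$ with $\mu(\mathbf 1)=1$). $G$ is amenable if there is $\mu\in\mathrm{M}(G)$ with $\mu(f\circ\lambda_g)=\mu(f)$ for all $f\in\mathrm{RUCB}(G)$, $g\in G$. A Borel probability measure $\mu$ on $G$ is regular if $\mu(B)=\sup\{\mu(K)\mid K\subseteq B \text{ compact}\}$ for every Borel $B\subseteq G$, and non-degenerate if its support $\mathrm{spt}(\mu)=\{x\in G\mid \mu(U)>0 \text{ for all open } U\ni x\}$ generates a dense subsemigroup of $G$. Let $G$ act continuously by isometries on a metric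 space $Y$. A bounded measurable $f\colon Y\to\mathbb{R}$ is $\mu$-harmonic if $f(y)=\int f(gy)\,d\mu(g)$ for all $y\in Y$. The action of $G$ on $Y$ is $\mu$-Liouville if every $\mu$-harmonic uniformly continuous bounded function $Y\to\mathbb{R}$ is constant, and Liouville if it is $\nu$-Liouville for some non-degenerate, regular Borel probability measure $\nu$ on $G$. *)

(* Defs.v *)
From HB Require Import structures.
From mathcomp Require Import all_boot all_order all_algebra.
From mathcomp Require Import all_classical all_reals all_analysis.
From mathcomp Require Import complex.

Set Implicit Arguments.
Unset Strict Implicit.
Unset Printing Implicit Defensive.

Import Order.TTheory GRing.Theory Num.Theory.
Import numFieldNormedType.Exports.

Local Open Scope classical_set_scope.
Local Open Scope ring_scope.

Definition separable (T : topologicalType) : Prop :=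
  exists D : set T, countable D /\ dense D.

(* X^n is 'rV[X]_n, whose library (pseudo)metric structure is that of the
   supremum distance; the default 0 of the maximum only matters for n = 0. *)
Section row_metric.
Variables (R : realType) (X : metricType R) (n : nat).
Implicit Types x y : 'rV[X]_n.

Definition row_dist x y : R :=
  \big[Num.max/0]_(i < n) mdist (x ord0 i) (y ord0 i).

Lemma row_dist_ge0 x y : 0 <= row_dist x y.
Proof. exact: bigmax_ge_id. Qed.

Lemma row_dist_positivity x y : row_dist x y = 0 -> x = y.
Proof.
move=> d0; apply/rowP => i; apply: (@mdist_positivity R X); apply/eqP.
by rewrite eq_le mdist_ge0 andbT -d0; exact: le_bigmax.
Qed.

Lemma row_ballE x (d : R) : ball x d = [set y | row_dist x y < d].
Proof.
apply/seteqP; split => y /=.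
  move=> [d0 xy]; apply: bigmax_lt => // i _.
  by have := xy ord0 i; rewrite ballEmdist.
move=> xyd; have d0 := le_lt_trans (row_dist_ge0 x y) xyd.
split=> // i j; rewrite ballEmdist/= (ord1 i).
by apply: le_lt_trans xyd; exact: (le_bigmax _ _ j).
Qed.

HB.instance Definition _ := PseudoMetric_isMetric.Build R 'rV[X]_n
  row_dist_ge0 row_dist_positivity row_ballE.

End row_metric.

Section subset_metric.
Variables (R : realType) (X : metricType R) (A : set X).
Implicit Types x y : A.

Definition subset_dist x y : R := mdist (set_val x) (set_val y).

Lemma subset_dist_ge0 x y : 0 <= subset_dist x y.
Proof. exact: mdist_ge0. Qed.

Lemma subset_dist_positivity x y : subset_dist x y = 0 -> x = y.
Proof. by move/mdist_positivity => /val_inj. Qed.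

Lemma subset_ballE x (d : R) : ball x d = [set y | subset_dist x y < d].
Proof.
have -> : ball x d = set_val @^-1` ball (set_val x) d by [].
by rewrite ballEmdist.
Qed.

HB.instance Definition _ := PseudoMetric_isMetric.Build R (set_type A)
  subset_dist_ge0 subset_dist_positivity subset_ballE.

End subset_metric.

HB.mixin Record isTopologicalGroup G & Group G & PointedTopological G := {
  mulg_continuous : continuous (fun p : G * G => (p.1 * p.2)%g);
  invg_continuous : continuous (fun x : G => x^-1%g)
}.

#[short(type="topGroupType")]
HB.structure Definition TopologicalGroup :=
  {G of Group G & PointedTopological G & isTopologicalGroup G}.

Section subgroup_type.
Variables (G : topGroupType) (S : groupClosed G).

Definition subgroup_type : Type := {g : G | g \in S}.

HB.instance Definition _ := SubType.on subgroup_type.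
HB.instance Definition _ := Choice.on subgroup_type.

Lemma subgroup_group_closed : group_closed S.
Proof. by split=> [|g h gS hS]; [exact: gpred1 | exact: gpredF]. Qed.

HB.instance Definition _ :=
  SubChoice_isSubGroup.Build G _ subgroup_type subgroup_group_closed.
HB.instance Definition _ := isPointed.Build subgroup_type 1%g.
HB.instance Definition _ := Topological.copy subgroup_type
  (initial_topology (val : subgroup_type -> G)).

Lemma subgroup_val_continuous : continuous (val : subgroup_type -> G).
Proof. exact: initial_continuous. Qed.

Lemma subgroup_mulg_continuous :
  continuous (fun p : subgroup_type * subgroup_type => (p.1 * p.2)%g).
Proof.
apply: (@continuous_comp_initial subgroup_type _ G val) => -[g h].
have -> : val \o (fun p : subgroup_type * subgroup_type => (p.1 * p.2)%g) =
  (fun q : G * G => (q.1 * q.2)%g) \o (fun p => (val p.1, val p.2)).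
  by apply/funext.
apply: (@continuous_comp _ _ _
  (fun p : subgroup_type * subgroup_type => (val p.1, val p.2) : G * G));
  last exact: mulg_continuous.
apply: cvg_pair => /=.
- by apply: (cvg_comp _ _ cvg_fst); exact: subgroup_val_continuous.
- by apply: (cvg_comp _ _ cvg_snd); exact: subgroup_val_continuous.
Qed.

Lemma subgroup_invg_continuous : continuous (fun g : subgroup_type => g^-1%g).
Proof.
apply: (@continuous_comp_initial subgroup_type _ G val) => g.
have -> : val \o (fun g : subgroup_type => g^-1%g) = (fun h : G => h^-1%g) \o val.
  by apply/funext.
apply: continuous_comp; first exact: subgroup_val_continuous.
exact: invg_continuous.
Qed.

HB.instance Definition _ := isTopologicalGroup.Build subgroup_type
  subgroup_mulg_continuous subgroup_invg_continuous.

End subgroup_type.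

Section isometry_group.
Variables (R : realType) (X : metricType R).

Definition isometries : set {ptws X -> X} :=
  [set f : X -> X | bijective f /\ forall x y, mdist (f x) (f y) = mdist x y].

(* The library topology on set_type makes this the subspace topology of
   {ptws X -> X}, that is, pointwise convergence. *)
Definition Iso : Type := isometries.
HB.instance Definition _ := Topological.on Iso.

Definition Iso_fun (g : Iso) : X -> X := set_val g.
Coercion Iso_fun : Iso >-> Funclass.

Lemma Iso_bij (g : Iso) : bijective g.
Proof. by have [] := set_mem (proj2_sig g). Qed.

Lemma Iso_mdist (g : Iso) x y : mdist (g x) (g y) = mdist x y.
Proof. by have [_] := set_mem (proj2_sig g); apply. Qed.

Lemma Iso_eq (g h : Iso) : g =1 h -> g = h.
Proof. by move=> gh; apply/val_inj/funext. Qed.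

Lemma isometries1 : isometries id.
Proof. by split=> //; exists id. Qed.

Lemma isometriesM (g h : Iso) : isometries (g \o h).
Proof.
split=> [|x y /=]; last by rewrite !Iso_mdist.
exact: bij_comp (Iso_bij g) (Iso_bij h).
Qed.

Lemma Iso_inv_subproof (g : Iso) : exists f : X -> X, cancel g f /\ cancel f g.
Proof. by have [f gK fK] := Iso_bij g; exists f. Qed.

Definition Iso_inv_fun (g : Iso) : X -> X := projT1 (cid (Iso_inv_subproof g)).

Lemma Iso_inv_funK (g : Iso) : cancel g (Iso_inv_fun g).
Proof. by rewrite /Iso_inv_fun; case: cid => f []. Qed.

Lemma Iso_funK (g : Iso) : cancel (Iso_inv_fun g) g.
Proof. by rewrite /Iso_inv_fun; case: cid => f []. Qed.

Lemma isometriesV (g : Iso) : isometries (Iso_inv_fun g).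
Proof.
split=> [|x y]; last by rewrite -(Iso_mdist g) !Iso_funK.
by exists g; [exact: Iso_funK | exact: Iso_inv_funK].
Qed.

Definition Iso_one : Iso := 
  exist (fun f => f \in isometries) id (mem_set isometries1).
Definition Iso_mul (g h : Iso) : Iso := 
  exist (fun f => f \in isometries) (g \o h) (mem_set (isometriesM g h)).
Definition Iso_inv (g : Iso) : Iso := 
  exist (fun f => f \in isometries) (Iso_inv_fun g) (mem_set (isometriesV g)).

Lemma Iso_mulA : associative Iso_mul.
Proof. by move=> f g h; exact: Iso_eq. Qed.

Lemma Iso_mul1 : left_id Iso_one Iso_mul.
Proof. by move=> g; exact: Iso_eq. Qed.

Lemma Iso_1mul : right_id Iso_one Iso_mul.
Proof. by move=> g; exact: Iso_eq. Qed.

Lemma Iso_mulV : left_inverse Iso_one Iso_inv Iso_mul.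
Proof. by move=> g; apply: Iso_eq => x; exact: Iso_inv_funK. Qed.

Lemma Iso_Vmul : right_inverse Iso_one Iso_inv Iso_mul.
Proof. by move=> g; apply: Iso_eq => x; exact: Iso_funK. Qed.

HB.instance Definition _ := isGroup.Build Iso
  Iso_mulA Iso_mul1 Iso_1mul Iso_mulV Iso_Vmul.
HB.instance Definition _ := isPointed.Build Iso 1%g.

Lemma Iso_eval_continuous (x : X) : continuous (fun g : Iso => g x).
Proof.
move=> g; apply: (@continuous_comp Iso {ptws X -> X} X set_val (@^~ x)).
  exact: initial_continuous.
exact: (@proj_continuous X (fun=> X) x).
Qed.

Lemma continuous_Iso (T : topologicalType) (f : T -> Iso) :
  (forall x : X, continuous (fun t => f t x)) -> continuous f.
Proof.
move=> fc; apply: (@continuous_comp_initial Iso _ {ptws X -> X} set_val) => t.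
by apply/pointwise_cvgP => x; exact: fc.
Qed.

Lemma Iso_mul_mdist (p q : Iso * Iso) (x : X) :
  mdist (((p.1 * p.2)%g : Iso) x) (((q.1 * q.2)%g : Iso) x) <=
  mdist (p.1 (p.2 x)) (q.1 (p.2 x)) + mdist (p.2 x) (q.2 x).
Proof. by rewrite -(Iso_mdist q.1 (p.2 x)); exact: metric_triangle. Qed.

Lemma Iso_mulg_continuous : continuous (fun p : Iso * Iso => (p.1 * p.2)%g).
Proof.
apply: continuous_Iso => x p.
apply/metricType_numDomainType.cvgrPdist_lt => e e0.
have e20 : 0 < e / 2 by rewrite divr_gt0.
have c1 y : continuous (fun q : Iso * Iso => Iso_fun q.1 y).
  move=> q; apply: (@continuous_comp _ _ _ fst (fun g : Iso => g y)).
    exact: cvg_fst.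
  exact: Iso_eval_continuous.
have c2 y : continuous (fun q : Iso * Iso => Iso_fun q.2 y).
  move=> q; apply: (@continuous_comp _ _ _ snd (fun g : Iso => g y)).
    exact: cvg_snd.
  exact: Iso_eval_continuous.
near=> q; apply: le_lt_trans (Iso_mul_mdist p q x) _.
rewrite [ltRHS]splitr; apply: ltrD; near: q.
- by have /metricType_numDomainType.cvgrPdist_lt := c1 (Iso_fun p.2 x) p; exact.
- by have /metricType_numDomainType.cvgrPdist_lt := c2 x p; exact.
Unshelve. all: by end_near. Qed.

Lemma Iso_invg_continuous : continuous (fun g : Iso => g^-1%g).
Proof.
apply: continuous_Iso => x g; have FF : Filter (nbhs (g : Iso)).
  exact: nbhs_filter.
apply/metricType_numDomainType.cvgrPdist_lt => e e0.
near=> h; rewrite -(Iso_mdist h).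
have -> : Iso_fun h (Iso_fun h^-1%g x) = x by exact: Iso_funK.
rewrite -[X in mdist _ X](Iso_funK g x) metric_sym; near: h.
have /metricType_numDomainType.cvgrPdist_lt :=
  @Iso_eval_continuous (Iso_fun g^-1%g x) g.
exact.
Unshelve. all: by end_near. Qed.

HB.instance Definition _ := isTopologicalGroup.Build Iso
  Iso_mulg_continuous Iso_invg_continuous.

End isometry_group.

Section amenability.
Variables (R : realType) (G : topGroupType).
Implicit Types (f : G -> R[i]) (m : (G -> R[i]) -> R[i]).

Definition right_unif_continuous f : Prop :=
  forall e : R, 0 < e -> exists2 U : set G, nbhs 1%g U &
    forall x y : G, U (x * y^-1)%g -> `|f x - f y| <= e%:C%C.

Definition RUCB : set (G -> R[i]) :=
  [set f | right_unif_continuous f /\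
    exists M : R, forall x, `|f x| <= M%:C%C].

(* A functional on RUCB is encoded as a total map on G -> R[i], of which only
   the restriction to RUCB matters.  In the order of R[i], 0 <= z means that z
   is real and nonnegative. *)
Definition state m : Prop :=
  [/\ forall (a : R[i]) f1 f2, RUCB f1 -> RUCB f2 ->
        m (fun x => a * f1 x + f2 x) = a * m f1 + m f2,
      forall f, RUCB f -> (forall x, 0 <= f x) -> 0 <= m f &
      m (fun=> 1) = 1].

Definition amenable : Prop := exists2 m, state m &
  forall f (g : G), RUCB f -> m (fun x => f (g * x)%g) = m f.

End amenability.

Definition borelType (T : ptopologicalType) := g_sigma_algebraType (@open T).

Section borel_measures.
Variables (R : realType) (G : topGroupType).
Variable mu : probability (borelType G) R.

Definition regular_measure : Prop := forall B : set (borelType G),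
  measurable B -> mu B = ereal_sup [set mu K | K in
    [set K : set G | compact K /\ K `<=` B]].

Definition spt : set G :=
  [set x | forall U : set G, open U -> U x -> (0 < mu U)%E].

Definition generated_subsemigroup (A : set G) : set G :=
  smallest [set S : set G | forall x y, S x -> S y -> S (x * y)%g] A.

Definition non_degenerate : Prop := dense (generated_subsemigroup spt).

End borel_measures.

Record isometric_action (R : realType) (G : topGroupType) (Y : metricType R) :=
  IsometricAction {
    act :> G -> Y -> Y;
    act1 : forall y, act 1%g y = y;
    actM : forall g h y, act (g * h)%g y = act g (act h y);
    act_mdist : forall g y z, mdist (act g y) (act g z) = mdist y z;
    act_continuous : continuous (fun p : G * Y => act p.1 p.2)
  }.

Section liouville.
Variables (R : realType) (G : topGroupType) (Y : metricType R).
Variable a : isometric_action G Y.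
Implicit Types (f : Y -> R) (mu : probability (borelType G) R).

(* Stated with <<s _ >> because measurable types are pointed and Y need not
   be. *)
Definition borel_measurable f : Prop :=
  forall B : set R, measurable B -> <<s (@open Y) >> (f @^-1` B).

Definition bounded f : Prop := exists M : R, forall y, `|f y| <= M.

Definition harmonic mu f : Prop :=
  [/\ bounded f, borel_measurable f &
      forall y, (f y)%:E = (\int[mu]_g (f (a g y))%:E)%E].

Definition mu_liouville mu : Prop := forall f,
  harmonic mu f -> unif_continuous f -> bounded f ->
  exists c : R, forall y, f y = c.

Definition liouville : Prop := exists nu : probability (borelType G) R,
  [/\ non_degenerate nu, regular_measure nu & mu_liouville nu].

End liouville.

Section orbits.
Variables (R : realType) (X : metricType R) (G : groupClosed (Iso X)).
Variables (n : nat) (x : 'rV[X]_n).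

Definition row_act (g : subgroup_type G) (y : 'rV[X]_n) : 'rV[X]_n :=
  map_mx (Iso_fun (val g)) y.

Definition row_orbit : set 'rV[X]_n := range (row_act^~ x).

Lemma row_act1 y : row_act 1%g y = y.
Proof. by apply/rowP => i; rewrite mxE. Qed.

Lemma row_actM g h y : row_act (g * h)%g y = row_act g (row_act h y).
Proof. by apply/rowP => i; rewrite !mxE. Qed.

Lemma row_act_mdist g (y z : 'rV[X]_n) :
  mdist (row_act g y) (row_act g z) = mdist y z.
Proof. by apply: eq_bigr => i _; rewrite !mxE Iso_mdist. Qed.

Lemma row_act_orbit g y : row_orbit y -> row_orbit (row_act g y).
Proof. by move=> [h _ <-]; exists (g * h)%g => //; rewrite row_actM. Qed.

Definition orbit_act (g : subgroup_type G) (y : row_orbit) : row_orbit :=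
  exist (fun z => z \in row_orbit) (row_act g (val y))
    (mem_set (row_act_orbit g (set_mem (valP y)))).

Lemma orbit_act1 y : orbit_act 1%g y = y.
Proof. by apply: val_inj; exact: row_act1. Qed.

Lemma orbit_actM g h y : orbit_act (g * h)%g y = orbit_act g (orbit_act h y).
Proof. by apply: val_inj; exact: row_actM. Qed.

Lemma orbit_act_mdist g y z : mdist (orbit_act g y) (orbit_act g z) = mdist y z.
Proof. exact: row_act_mdist. Qed.

Lemma row_act_mdist_lt (y : 'rV[X]_n) (g : subgroup_type G) (e : R) : 0 < e ->
  \forall h \near g, mdist (row_act g y) (row_act h y) < e.
Proof.
move=> e0.
have FF : Filter (nbhs (g : subgroup_type G)) by exact: nbhs_filter.
have gc i : \forall h \near g,
    mdist (Iso_fun (val g) (y ord0 i)) (Iso_fun (val h) (y ord0 i)) < e.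
  have c : continuous (fun h : subgroup_type G => Iso_fun (val h) (y ord0 i)).
    move=> h; apply: (@continuous_comp _ _ _
      (val : subgroup_type G -> Iso X) (fun k : Iso X => k (y ord0 i))).
      exact: subgroup_val_continuous.
    exact: Iso_eval_continuous.
  by have /metricType_numDomainType.cvgrPdist_lt := c g; exact.
have := filter_forall FF gc; apply: filterS => h gh.
by apply: bigmax_lt => // i _; rewrite !mxE; exact: gh.
Qed.

Lemma orbit_act_continuous :
  continuous (fun p : subgroup_type G * row_orbit => orbit_act p.1 p.2).
Proof.
move=> -[g y]; apply/metricType_numDomainType.cvgrPdist_lt => e e0.
have e20 : 0 < e / 2 by rewrite divr_gt0.
exists ([set h | mdist (row_act g (val y)) (row_act h (val y)) < e / 2],
        [set z | mdist y z < e / 2]) => /=.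
  split; first exact: row_act_mdist_lt.
  by rewrite -metricType_numDomainType.filter_from_mdist_nbhs; exists (e / 2).
move=> [h z] /= [gh yz].
have /le_lt_trans := @metric_triangle R _
  (orbit_act g y) (orbit_act h y) (orbit_act h z).
by apply; rewrite [ltRHS]splitr orbit_act_mdist ltrD.
Qed.

Definition orbit_action : isometric_action (subgroup_type G) row_orbit :=
  IsometricAction orbit_act1 orbit_actM orbit_act_mdist orbit_act_continuous.

End orbits.

(* Main.v *)
(* (=>) An amenable group carries, for every finite set E, a finitely supported
   probability that is almost invariant under right translations by E, uniformly
   over the 1-Lipschitz functions bounded by 1 for the pseudometric
   d(g x, h x): the invariant mean handles one function at a time, and a minimax
   argument over the compact set of Lipschitz functions makes this uniform.
   Following Kaimanovich and Vershik, the measure is a series with weights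
   2^-(i+1) of such probabilities alpha_i, each almost invariant under all words
   of length < 4^m in the supports of its predecessors.  Expanding a harmonic
   function along the random walk until some alpha_i with i >= m is drawn shows
   that it is almost constant.  The measure has countably many atoms, hence is
   regular, and the atoms include a dense sequence.

   (<=) Cesaro means of the iterated convolutions of f with the Liouville measure
   have a limit along an ultrafilter which is harmonic, hence constant on orbits;
   its value at 1 is a mean that is invariant under right translations on
   Lipschitz functions for d(g x, h x).  These pseudometrics generate the left
   uniformity of G, so an ultralimit over all tuples x, composed with the
   inversion, is a left invariant mean. *)
From HB Require Import structures.
Require Import Defs.
From mathcomp Require Import finmap.
From mathcomp Require Import all_boot all_order all_algebra.
From mathcomp Require Import all_classical all_reals all_analysis.
From mathcomp Require Import measurable_realfun complex ring lra.

Set Implicit Arguments.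
Unset Strict Implicit.
Unset Printing Implicit Defensive.

Import Order.TTheory GRing.Theory Num.Theory.
Import numFieldNormedType.Exports.

Local Open Scope classical_set_scope.
Local Open Scope ring_scope.

(** * Finite weights and minimax *)

Section weights.
Context {R : realType} {I : choiceType}.
Implicit Types (s : seq (R * I)) (f g : I -> R).

(** A finitely supported probability is a list of pairs (mass, point), in which points may
    repeat. *)
Definition wsum s f : R := \sum_(p <- s) p.1 * f p.2.

Definition is_weight s : Prop :=
  {in s, forall p, 0 <= p.1} /\ \sum_(p <- s) p.1 = 1.

Lemma wsumD s f g : wsum s (fun i => f i + g i) = wsum s f + wsum s g.
Proof. by rewrite /wsum -big_split; apply: eq_bigr => p _; rewrite mulrDr. Qed.

Lemma wsumZ s a f : wsum s (fun i => a * f i) = a * wsum s f.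
Proof. by rewrite /wsum big_distrr; apply: eq_bigr => p _; rewrite mulrCA. Qed.

Lemma wsumB s f g : wsum s (fun i => f i - g i) = wsum s f - wsum s g.
Proof.
by rewrite /wsum -sumrB; apply: eq_bigr => p _; rewrite mulrBr.
Qed.

Lemma wsum_cst s c : is_weight s -> wsum s (fun=> c) = c.
Proof. by move=> [_ s1]; rewrite /wsum -mulr_suml s1 mul1r. Qed.

Lemma wsum_norm_le s f c : is_weight s -> (forall p, p \in s -> `|f p.2| <= c) ->
  `|wsum s f| <= c.
Proof.
move=> s1 fc; rewrite -[leRHS](wsum_cst _ s1) /wsum.
apply: le_trans (ler_norm_sum _ _ _) _.
rewrite big_seq [leRHS]big_seq; apply: ler_sum => p ps.
case: s1 => + _ => /(_ _ ps) p0; rewrite normrM (ger0_norm p0).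
by apply: ler_wpM2l => //; exact: fc.
Qed.

End weights.

(* The weights are read off the point of K minimizing the squared distance of
   the vector of values to the orthant [v >= e]: they are the components of the
   inner normal there. *)
Lemma minimax (R : realType) (T : topologicalType) (I : choiceType)
    (K : set T) (Phi : I -> T -> R) (e : R) :
  K !=set0 -> compact K -> (forall i, continuous (Phi i)) ->
  (forall f g t, K f -> K g -> 0 <= t <= 1 ->
     exists2 h, K h & forall i, Phi i h = (1 - t) * Phi i f + t * Phi i g) ->
  (forall f, K f -> exists i, Phi i f < e) ->
  exists2 s, is_weight s & forall f, K f -> wsum s (Phi^~ f) < e.
Proof.
move=> K0 cK cPhi cvxK small.
(* Compactness leaves finitely many indices. A point of [K] supplies the base point that
   [compact_cover] asks for. *)
have [J _ KJ] : finite_subset_cover [set: I] (fun i => [set f | Phi i f < e]) K.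
  have [f0 _] := K0; pose pT := isPointed.Build T f0.
  pose T' : ptopologicalType := HB.pack T pT.
  have : @compact T' K by exact: cK.
  rewrite compact_cover; apply.
    move=> i _; apply: open_comp (@open_lt R e).
    by move=> x _; exact: cPhi.
  by move=> f /small[i fi]; exists i.
pose pos (x : R) := Num.max 0 x.
have pos0 x : 0 <= pos x by rewrite /pos le_max lexx.
have posM x : pos x * x = pos x ^+ 2.
  by rewrite /pos /Num.max; case: ifPn => [_|]; rewrite ?expr2// ?mul0r// -leNgt.
(* Bounds the truncated square after a perturbation by a plain quadratic polynomial in the
   perturbation. *)
have posB (a b : R) : pos (a - b) ^+ 2 <= (pos a - b) ^+ 2.
  rewrite /pos /Num.max; case: (ltP 0 (a - b)) => ab; case: (ltP 0 a) => a0 //.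
  - by apply: lerXn2r; rewrite ?nnegrE; lra.
  - by rewrite expr0n/= sqr_ge0.
  - by rewrite expr0n/= sqr_ge0.
pose psi f := \sum_(i <- J) pos (e - Phi i f) ^+ 2.
have cpsi : continuous psi.
  rewrite /psi => f; apply: cvg_big => //= [|i _]; first exact: add_continuous.
  have cp : continuous pos.
    move=> x; rewrite /pos; apply: (@continuous_max _ _ (fun=> 0) id x).
      exact: cst_continuous.
    exact: cvg_id.
  have cd : (pos \o (fun f => e - Phi i f)) @ f --> pos (e - Phi i f).
    apply: (@continuous_comp _ _ _ (fun f => e - Phi i f) pos); last exact: cp.
    by apply: cvgB; [exact: cvg_cst|exact: cPhi].
  exact: (cvgM cd cd).
have [f0 f0K f0min] := compact_EVT_min K0 cK (continuous_subspaceT cpsi).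
have {}f0K : K f0 by rewrite inE in f0K.
have {}f0min g : K g -> psi f0 <= psi g by move=> Kg; apply: f0min; rewrite inE.
pose w i := pos (e - Phi i f0).
have W0 : 0 < \sum_(i <- J) w i.
  have [i iJ fi] := KJ _ f0K.
  rewrite (big_rem i)//=; apply: ltr_pwDl; last by apply: sumr_ge0 => j _; exact: pos0.
  by rewrite /w /pos lt_max; apply/orP; right; rewrite subr_gt0.
have W20 : 0 < \sum_(i <- J) w i ^+ 2.
  have [i iJ fi] := KJ _ f0K.
  rewrite (big_rem i)//=; apply: ltr_pwDl.
    by rewrite exprn_gt0// /w /pos lt_max; apply/orP; right; rewrite subr_gt0.
  by apply: sumr_ge0 => j _; exact: sqr_ge0.
set W := \sum_(i <- J) w i in W0.
(* First-order optimality at the minimizer [f0]: moving towards [g] by [t] changes [psi] by at most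
   [- 2 * t * D + t ^ 2 * Q]. *)
have var g : K g -> \sum_(i <- J) w i * (Phi i g - Phi i f0) <= 0.
  move=> Kg; set D := \sum_(i <- J) _.
  pose Q := \sum_(i <- J) (Phi i g - Phi i f0) ^+ 2.
  have Q0 : 0 <= Q by apply: sumr_ge0 => i _; exact: sqr_ge0.
  have DQ t : 0 < t <= 1 -> 2 * D <= t * Q.
    move=> /andP[t0 t1]; have [|h Kh hE] := cvxK f0 g t f0K Kg; first by lra.
    rewrite -(ler_pM2l t0).
    suff : psi h <= psi f0 - t * (2 * D) + t * (t * Q).
      by have := f0min _ Kh; lra.
    rewrite /psi /D /Q !mulr_sumr -sumrB -big_split/=; apply: ler_sum => i _.
    have -> : e - Phi i h = (e - Phi i f0) - t * (Phi i g - Phi i f0).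
      by rewrite hE; ring.
    apply: le_trans (posB _ _) _; rewrite -/(w i) le_eqVlt; apply/orP; left.
    by apply/eqP; ring.
  rewrite leNgt; apply/negP => D0.
  have Q10 : 0 < Q + 1 + D by lra.
  (* If [D > 0], this [t] lies in ]0, 1] and satisfies [t * Q <= D], against [2 * D <= t * Q]. *)
  have := DQ (D / (Q + 1 + D)).
  rewrite divr_gt0// ler_pdivrMr// mul1r => /(_ _)H.
  have {}H : 2 * D <= D / (Q + 1 + D) * Q by apply: H; lra.
  have : D / (Q + 1 + D) * Q <= D.
    by rewrite mulrAC ler_pdivrMr// ler_pM2l//; lra.
  lra.
exists [seq (w i / W, i) | i <- J].
  split=> [p /mapP[i _ ->]/=|]; first by apply: divr_ge0; [exact: pos0|exact: ltW].
  by rewrite big_map/= -mulr_suml divff// gt_eqF.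
move=> g Kg; rewrite /wsum big_map/=.
under eq_bigr do rewrite mulrAC.
rewrite -mulr_suml ltr_pdivrMr//.
(* By [var] it is enough to treat [f0], where [e * W] exceeds the weighted sum by the sum of the
   [w i ^+ 2]. *)
have /= := var g Kg; under eq_bigr do rewrite mulrBr.
rewrite sumrB subr_le0 => /le_lt_trans; apply.
rewrite -subr_gt0 /W mulr_sumr -sumrB.
under eq_bigr do rewrite [e * _]mulrC -mulrBr posM.
by [].
Qed.

(** * Left uniformly continuous functions *)

Section topological_group.
Context {G : topGroupType}.

Lemma mulg2_continuous (a b : G) : continuous (fun x : G => (a * x * b)%g).
Proof.
have c1 : continuous (fun x : G => (a * x)%g).
  move=> x; apply: (@continuous_comp _ _ _ (fun x : G => (a, x))
    (fun p : G * G => (p.1 * p.2)%g)); last exact: mulg_continuous.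
  by apply: cvg_pair => /=; [exact: cvg_cst|exact: cvg_id].
move=> x; apply: (@continuous_comp _ _ _ (fun x : G => ((a * x)%g, b))
  (fun p : G * G => (p.1 * p.2)%g)); last exact: mulg_continuous.
by apply: cvg_pair => /=; [exact: c1|exact: cvg_cst].
Qed.

(** Makes right translates of left uniformly continuous functions left uniformly continuous. *)
Lemma nbhs1_conj (g : G) (U : set G) : nbhs 1%g U ->
  nbhs 1%g [set x | U (g * x * g^-1)%g].
Proof.
move=> U1; apply: (@mulg2_continuous g g^-1%g 1%g) => /=.
by rewrite mulg1 mulgV.
Qed.

Lemma nbhs_div (x : G) (U : set G) : nbhs 1%g U ->
  \forall y \near x, U (x^-1 * y)%g.
Proof.
move=> U1; rewrite /prop_near1/=.
have -> : (fun y => U (x^-1 * y)%g) = (fun y => U (x^-1 * y * 1)%g).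
  by apply/funext => y; rewrite mulg1.
by apply: (@mulg2_continuous x^-1%g 1%g x) => /=; rewrite mulg1 mulVg.
Qed.

End topological_group.

Section left_uniform.
Context {R : realType} {G : topGroupType}.
Implicit Types (f : G -> R) (rho : G -> G -> R).

(** Inversion exchanges these functions with right uniformly continuous ones. The left uniformity is
    the one adapted to the distances d(g x, h x). *)
Definition left_unif_continuous f : Prop :=
  forall e : R, 0 < e -> exists2 U : set G, nbhs 1%g U &
    forall x y, U (x^-1 * y)%g -> `|f x - f y| <= e.

Lemma left_unif_continuous_continuous f : left_unif_continuous f -> continuous f.
Proof.
move=> fu x; apply/cvgrPdist_le => e e0; have [U U1 fU] := fu _ e0.
by apply: filterS (nbhs_div x U1) => y; exact: fU.
Qed.

Lemma left_unif_continuousZD a f g : left_unif_continuous f ->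
  left_unif_continuous g -> left_unif_continuous (fun x => a * f x + g x).
Proof.
move=> fu gu e e0; have a0 : 0 < `|a| + 1 by rewrite ltr_wpDl.
have [|U U1 fU] := fu (e / 2 / (`|a| + 1)); first by rewrite !divr_gt0.
have [|V V1 gV] := gu (e / 2); first by rewrite divr_gt0.
exists (U `&` V); first exact: filterI.
move=> x y [/fU xyf /gV xyg].
have -> : a * f x + g x - (a * f y + g y) = a * (f x - f y) + (g x - g y).
  by ring.
apply: le_trans (ler_normD _ _) _; rewrite [leRHS]splitr lerD// normrM.
apply: le_trans (ler_wpM2l _ xyf) _ => //.
rewrite mulrCA ger_pMr ?divr_gt0// ler_pdivrMr// mul1r; lra.
Qed.

(** Abstracts the pseudometrics d(g x, h x) given by a tuple x. *)
Record left_pseudometric rho : Prop := {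
  pdistxx : forall x, rho x x = 0;
  pdist_sym : forall x y, rho x y = rho y x;
  pdist_triangle : forall x y z, rho x z <= rho x y + rho y z;
  pdist_left : forall g x y, rho (g * x)%g (g * y)%g = rho x y;
  pdist_near1 : forall e, 0 < e -> \forall g \near (1%g : G), rho 1%g g < e
}.

Definition lip rho (L : R) f : Prop := forall x y, `|f x - f y| <= L * rho x y.

Definition rho_unif_continuous rho f : Prop :=
  forall e, 0 < e -> exists2 d, 0 < d & forall x y, rho x y < d -> `|f x - f y| <= e.

Section pseudometric.
Context {rho : G -> G -> R} (rhoP : left_pseudometric rho).

Lemma pdist_ge0 x y : 0 <= rho x y.
Proof.
have := pdist_triangle rhoP x y x; rewrite (pdistxx rhoP).
by rewrite (pdist_sym rhoP y x); lra.
Qed.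

Lemma rho_left_unif_continuous f :
  rho_unif_continuous rho f -> left_unif_continuous f.
Proof.
move=> fu e e0; have [d d0 fd] := fu _ e0.
exists [set g | rho 1%g g < d]; first exact: pdist_near1.
by move=> x y /= xyd; apply: fd; rewrite -(pdist_left rhoP x^-1%g) mulVg.
Qed.

Lemma lip_rho_unif_continuous L f : lip rho L f -> rho_unif_continuous rho f.
Proof.
move=> fL e e0; have L0 : 0 < `|L| + 1 by rewrite ltr_wpDl.
exists (e / (`|L| + 1)) => [|x y]; first by rewrite divr_gt0.
rewrite ltr_pdivlMr// => /ltW xyd; apply: le_trans (fL x y) _.
apply: le_trans xyd; rewrite mulrC ler_wpM2l ?pdist_ge0//.
by have := ler_norm L; lra.
Qed.

(* McShane's formula *)
Lemma lip_approx f (M d e : R) : 0 < d -> 0 <= e -> (forall x, `|f x| <= M) ->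
  (forall x y, rho x y < d -> `|f x - f y| <= e) ->
  exists g, [/\ lip rho (2 * M / d) g, forall x, `|g x| <= M &
    forall x, `|f x - g x| <= e].
Proof.
move=> d0 e0 fM fd; have M0 : 0 <= M by apply: le_trans (fM 1%g).
set L := 2 * M / d; have L0 : 0 <= L by rewrite divr_ge0 ?mulr_ge0// ltW.
have fM' x : - M <= f x <= M by rewrite -ler_norml.
have rL0 x y : 0 <= L * rho x y by rewrite mulr_ge0// pdist_ge0.
pose S x := range (fun w => f w + L * rho w x).
have Slb x : lbound (S x) (- M).
  by move=> _ [w _ <-]; have := fM' w; have := rL0 w x; lra.
have S0 x : S x !=set0 by exists (f 1%g + L * rho 1%g x), 1%g.
have Sle x w : inf (S x) <= f w + L * rho w x.
  by apply: ge_inf; [exists (- M)|exists w].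
have gf x : inf (S x) <= f x.
  by have := Sle x x; rewrite (pdistxx rhoP) mulr0 addr0.
exists (fun x => inf (S x)); split.
- have H x y : inf (S x) - inf (S y) <= L * rho x y.
    rewrite lerBlDr -lerBlDl; apply: lb_le_inf => // _ [w _ <-].
    rewrite lerBlDl; apply: le_trans (Sle x w) _.
    have := pdist_triangle rhoP w y x; rewrite (pdist_sym rhoP y x).
    by move=> /(ler_wpM2l L0); lra.
  move=> x y; rewrite ler_norml H andbT.
  by have := H y x; rewrite (pdist_sym rhoP y x); lra.
- move=> x; rewrite ler_norml; apply/andP; split; first exact: lb_le_inf.
  by apply: le_trans (gf x) _; have := fM' x; lra.
- move=> x; rewrite ger0_norm ?subr_ge0// lerBlDl -lerBlDr.
  apply: lb_le_inf => // _ [w _ <-].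
  have [wx|wx] := ltP (rho w x) d.
    have := fd _ _ wx; rewrite distrC => /ler_normlP[_ xw].
    by have := rL0 w x; lra.
  (* Points at distance at least [d] cannot lower the infimum below [f x]: the penalty is at least
     [2 * M], the largest possible oscillation of [f]. *)
  have : 2 * M <= L * rho w x by rewrite /L mulrAC ler_pdivlMr// ler_wpM2l ?mulr_ge0.
  by have := fM' w; have := fM' x; lra.
Qed.

End pseudometric.

End left_uniform.

(** * Invariant means tested on Lipschitz functions *)

Section amenable_lip.
Context {R : realType} {G : topGroupType}.
Local Open Scope complex_scope.

Lemma normc_real (x : R) : `|x%:C| = `|x|%:C.
Proof. by rewrite normc_def/= expr0n addr0 sqrtr_sqr. Qed.

Lemma RUCB_real (f : G -> R) : left_unif_continuous f ->
  (exists M : R, forall x, `|f x| <= M) -> RUCB (fun x => (f x^-1%g)%:C).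
Proof.
move=> fu [M fM]; split=> [e e0|]; last first.
  by exists M => x; rewrite normc_real lecR.
have [U U1 fU] := fu _ e0; exists U => // x y xyU.
by rewrite -rmorphB normc_real lecR; apply: fU; rewrite invgK.
Qed.

Lemma RUCB_cst (c : R[i]) : RUCB (fun _ : G => c).
Proof.
split=> [e e0|]; first by exists setT; [exact: filterT|move=> *; rewrite subrr normr0 lecR ltW].
by case: c => a b; exists (Num.sqrt (a ^+ 2 + b ^+ 2)) => _; rewrite normc_def.
Qed.

(** After inversion the invariant mean kills every difference of [f g] and its right translate, so
    it sends the whole sum to 0. If the sum were at least [e] everywhere, its mean would be too. *)
Lemma amenable_lip (rho : G -> G -> R) (E : seq G) (f : G -> G -> R) (e : R) :
  amenable R G -> left_pseudometric rho -> (forall g, lip rho 1 (f g)) ->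
  (forall g x, `|f g x| <= 1) -> 0 < e ->
  exists h, \sum_(g <- E) (f g (h * g)%g - f g h) < e.
Proof.
move=> [m [mD m0 m1] mG] rhoP flip fle1 e0; apply: contrapT => /forallNP noh.
pose S (E : seq G) h := \sum_(g <- E) (f g (h * g)%g - f g h).
have flu g : left_unif_continuous (f g).
  exact/(rho_left_unif_continuous rhoP)/(lip_rho_unif_continuous rhoP (flip g)).
pose F g (x : G) := (f g x^-1%g)%:C.
have FR g : RUCB (F g) by apply: RUCB_real => //; exists 1.
pose S' E x := (S E x^-1%g)%:C.
have gu (g : G) (k : G -> R) : left_unif_continuous k ->
    left_unif_continuous (fun h => k (h * g)%g).
  move=> ku e' e'0; have [U U1 fU] := ku _ e'0.
  exists [set x | U (g^-1 * x * g^-1^-1)%g]; first exact: nbhs1_conj.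
  by move=> x y /= xyU; apply: fU; rewrite invgM -!mulgA; rewrite invgK -!mulgA in xyU.
have Slu E' : left_unif_continuous (S E').
  elim: E' => [|g E' IH].
    have -> : S [::] = fun=> 0 by apply/funext => h; rewrite /S big_nil.
    by move=> e' e'0; exists setT; [exact: filterT|move=> *; rewrite subrr normr0 ltW].
  have -> : S (g :: E') = fun h => 1 * f g (h * g)%g + (-1 * f g h + S E' h).
    by apply/funext => h; rewrite /S big_cons; ring.
  by apply: left_unif_continuousZD; [exact: gu|exact: left_unif_continuousZD].
have Sb E' : exists M : R, forall h, `|S E' h| <= M.
  exists ((size E')%:R * 2) => h; rewrite /S; apply: le_trans (ler_norm_sum _ _ _) _.
  apply: le_trans (ler_sum _ (_ : forall g, true -> _ <= 2)) _; last first.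
    by rewrite big_const_seq count_predT iter_addr addr0 mulr_natl.
  move=> g _; apply: le_trans (ler_normB _ _) _.
  by have := fle1 g (h * g)%g; have := fle1 g h; lra.
have SR E' : RUCB (S' E') by exact: RUCB_real.
have mS E' : m (S' E') = 0.
  elim: E' => [|g E' IH].
    have := mD 1 (fun=> 0) (fun=> 0) (RUCB_cst 0) (RUCB_cst 0).
    rewrite !mul1r addr0.
    have -> : S' [::] = fun=> 0 by apply/funext => h; rewrite /S' /S big_nil.
    by move=> /eqP; rewrite -{1}[m _]addr0 (inj_eq (addrI _)) eq_sym => /eqP.
  (* Under inversion, right translation by [g] becomes left translation by [g^-1]. *)
  have Fg : RUCB (fun x => F g (g^-1 * x)%g).
    have -> : (fun x => F g (g^-1 * x)%g) = (fun x => (f g (x^-1 * g)%g)%:C).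
      by apply/funext => x; rewrite /F invgM invgK.
    by apply: (RUCB_real (gu g _ (flu g))); exists 1 => h; exact: fle1.
  have RS : RUCB (fun x => -1 * F g x + S' E' x).
    have := RUCB_real (left_unif_continuousZD (-1) (flu g) (Slu E')).
    have [M SM] := Sb E'.
    move=> H; have -> : (fun x => -1 * F g x + S' E' x) =
        (fun x => (-1 * f g x^-1%g + S E' x^-1%g)%:C).
      by apply/funext => x; rewrite /F /S' !rmorphD rmorphM/= rmorphN1.
    apply: H; exists (1 + M) => h; apply: le_trans (ler_normD _ _) _.
    by rewrite lerD// mulN1r normrN.
  have -> : S' (g :: E') = fun x => 1 * F g (g^-1 * x)%g + (-1 * F g x + S' E' x).
    apply/funext => x; rewrite /S' /S big_cons /F invgM invgK !(rmorphD, rmorphN)/=.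
    by rewrite mul1r mulN1r addrA.
  by rewrite mD// (mD _ _ _ (FR g) (SR E')) IH (mG _ _ (FR g)); ring.
have : 0 <= m (fun x => (- e)%:C * 1 + S' E x).
  apply: m0.
    have [M SM] := Sb E.
    have -> : (fun x => (- e)%:C * 1 + S' E x) =
        (fun x => (- e * 1 + S E x^-1%g)%:C).
      by apply/funext => x; rewrite /S' !mulr1 rmorphD.
    apply: (@RUCB_real (fun x => - e * 1 + S E x)).
      apply: left_unif_continuousZD => // e' e'0.
      by exists setT; [exact: filterT|move=> *; rewrite subrr normr0 ltW].
    exists (e + M) => x; rewrite mulr1; apply: le_trans (ler_normD _ _) _.
    by rewrite normrN gtr0_norm// lerD2l.
  move=> x; rewrite mulr1 -rmorphD/= ler0c addrC subr_ge0 leNgt.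
  by apply/negP; exact: noh.
rewrite mD ?mS ?m1 ?mulr1 ?addr0; [|exact: RUCB_cst|exact: SR].
by rewrite ler0c oppr_ge0 leNgt e0.
Qed.

End amenable_lip.

(** * Almost invariant weights *)

Section almost_invariance.
Context {R : realType} {G : topGroupType}.

(** By Tychonoff: the conditions involve at most two coordinates each and cut out a closed subset of
    a power of [-1, 1]. The index set [I] provides a separate function for each group element in the
    minimax argument. *)
Lemma compact_lip (I : choiceType) (rho : G -> G -> R) :
  compact [set F : {ptws I * G -> R} |
    forall i, lip rho 1 (fun x => F (i, x)) /\ forall x, `|F (i, x)| <= 1].
Proof.
have cF p : continuous (fun F : {ptws I * G -> R} => F p).
  by move=> F; exact: (@proj_continuous (I * G)%type (fun=> R : topologicalType) p).
pose C := [set F : {ptws I * G -> R} | forall p, `[(-1 : R), 1]%classic (F p)].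
have cC : compact C.
  apply: (@tychonoff (I * G)%type (fun=> R : topologicalType)
    (fun=> `[(-1 : R), 1]%classic)) => _.
  exact: segment_compact.
apply: subclosed_compact cC _; last first.
  by move=> F FK [i x]; rewrite /= in_itv/= -ler_norml; case: (FK i) => _; exact.
have -> : [set F : {ptws I * G -> R} |
    forall i, lip rho 1 (fun x => F (i, x)) /\ forall x, `|F (i, x)| <= 1] =
  (\bigcap_(q in [set: I * G * G])
    [set F : {ptws I * G -> R} | `|F q.1 - F (q.1.1, q.2)| <= rho q.1.2 q.2]) `&`
  (\bigcap_(p in [set: I * G]) [set F : {ptws I * G -> R} | `|F p| <= 1]).
  apply/seteqP; split=> F /=.
    move=> FK; split=> [[[i x] y]|[i x]] _ /=; case: (FK i) => Fl Fb //.
    by have := Fl x y; rewrite mul1r.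
  move=> [Fl Fb] i; split=> [x y|x]; last exact: (Fb (i, x)).
  by rewrite mul1r; exact: (Fl (i, x, y)).
apply: closedI; apply: closed_bigI => q _.
- apply: (@closed_comp _ _ (fun F : {ptws I * G -> R} => `|F q.1 - F (q.1.1, q.2)|)
    [set r | r <= rho q.1.2 q.2]); last exact: closed_le.
  by move=> F _; have := cvg_norm (cvgB (cF q.1 F) (cF (q.1.1, q.2) F)); exact.
- apply: (@closed_comp _ _ (fun F : {ptws I * G -> R} => `|F q|)
    [set r | r <= 1]); last exact: closed_le.
  by move=> F _; have := cvg_norm (cF q F); exact.
Qed.

(** Minimax over families of Lipschitz functions indexed by [G], with the payoff that [amenable_lip]
    makes small for each single family. *)
Lemma almost_invariant_weight (rho : G -> G -> R) (E : seq G) (e : R) :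
  amenable R G -> left_pseudometric rho -> 0 < e ->
  exists2 s, is_weight s & forall f g, lip rho 1 f -> (forall x, `|f x| <= 1) ->
    g \in E -> wsum s (fun h => f (h * g)%g) - wsum s f < e.
Proof.
move=> amG rhoP e0.
pose K := [set F : {ptws G * G -> R} |
  forall i, lip rho 1 (fun x => F (i, x)) /\ forall x, `|F (i, x)| <= 1].
(* Without duplicates, coordinate [g] of the family enters exactly one summand. *)
pose Phi h (F : {ptws G * G -> R}) := \sum_(g <- undup E) (F (g, h * g)%g - F (g, h)).
have rho0 x y : 0 <= 1 * rho x y by rewrite mul1r pdist_ge0.
have cF p : continuous (fun F : {ptws G * G -> R} => F p).
  by move=> F; exact: (@proj_continuous (G * G)%type (fun=> R : topologicalType) p).
have [|||F H t FK HK /andP[t0 t1]|F FK|s s1 sK] := @minimax R {ptws G * G -> R} G K Phi e.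
- by exists (fun=> 0) => i; split=> [x y|x]; rewrite ?subrr normr0.
- exact: compact_lip.
- move=> h; apply: continuous_big => [|g _ F]; first exact: add_continuous.
  by have := cvgB (cF (g, h * g)%g F) (cF (g, h) F); exact.
- exists (fun p => (1 - t) * F p + t * H p) => [i|h].
    have [Fl Fb] := FK i; have [Hl Hb] := HK i.
    have conv (a b c : R) : `|a| <= c -> `|b| <= c -> `|(1 - t) * a + t * b| <= c.
      move=> ac bc; apply: le_trans (ler_normD _ _) _.
      rewrite !normrM (ger0_norm t0) (@ger0_norm _ (1 - t)) ?subr_ge0//.
      have : (1 - t) * `|a| <= (1 - t) * c by rewrite ler_wpM2l ?subr_ge0.
      by have : t * `|b| <= t * c by [rewrite ler_wpM2l]; lra.
    split=> [x y|x]; last exact: conv.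
    rewrite (_ : _ - _ = (1 - t) * (F (i, x) - F (i, y)) + t * (H (i, x) - H (i, y))).
      exact: conv.
    by ring.
  rewrite /Phi !mulr_sumr -big_split/=; apply: eq_bigr => g _; ring.
- have [||h hF] := @amenable_lip R G rho (undup E) (fun g x => F (g, x)) e amG rhoP _ _ e0.
  + by move=> g; case: (FK g).
  + by move=> g; case: (FK g).
  + by exists h.
exists s => // f g fl fb gE.
(* The family vanishing outside coordinate [g] isolates the summand of [g]. *)
pose F : {ptws G * G -> R} := fun p => if p.1 == g then f p.2 else 0.
have FK : K F.
  move=> i; rewrite /F/=; case: eqP => _; split=> // [x y|x]; last by rewrite normr0.
  by rewrite subrr normr0.
have := sK _ FK; rewrite -wsumB; congr (_ < _); apply: eq_bigr => p _; congr (_ * _).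
rewrite /Phi (bigD1_seq g) ?mem_undup ?undup_uniq//= /F/= eqxx big1 ?addr0//.
by move=> g' /negPf ->; rewrite subrr.
Qed.

(** A small point mass at [d] is mixed in, so that [d] is an atom; applying the one-sided bound to
    [- f] as well makes it two-sided. *)
Lemma charging_almost_invariant_weight (rho : G -> G -> R) (E : seq G) (e : R) (d : G) :
  amenable R G -> left_pseudometric rho -> 0 < e ->
  exists s, [/\ is_weight s, exists2 c, 0 < c & (c, d) \in s &
    forall f g, lip rho 1 f -> (forall x, `|f x| <= 1) ->
    g \in E -> `|wsum s (fun h => f (h * g)%g) - wsum s f| <= e].
Proof.
(* The point mass costs at most [2 * c <= e / 2], and the almost invariant weight is taken with the
   remaining [e / 2]. *)
move=> amG rhoP e0; pose c := Num.min 1 (e / 4).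
have c0 : 0 < c by rewrite lt_min ltr01 divr_gt0.
have c1 : c <= 1 by rewrite ge_min lexx.
have ce : c <= e / 4 by rewrite ge_min lexx orbT.
have [|s s1 sE] := almost_invariant_weight E amG rhoP (_ : 0 < e / 2).
  by rewrite divr_gt0.
exists ((c, d) :: [seq ((1 - c) * p.1, p.2) | p <- s]).
have wsumE f : wsum ((c, d) :: [seq ((1 - c) * p.1, p.2) | p <- s]) f =
    c * f d + (1 - c) * wsum s f.
  rewrite /wsum big_cons big_map mulr_sumr/=; congr +%R.
  by apply: eq_bigr => p _; rewrite mulrA.
split; first split.
- move=> p; rewrite inE => /predU1P[->|/mapP[q qs ->]]/=; first exact: ltW.
  by rewrite mulr_ge0 ?subr_ge0//; case: s1 => + _; exact.
- by rewrite big_cons big_map/= -mulr_sumr; case: s1 => _ ->; ring.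
- by exists c => //; exact: mem_head.
- have H f g : lip rho 1 f -> (forall x, `|f x| <= 1) -> g \in E ->
    wsum s (fun h => f (h * g)%g) - wsum s f <= e / 2.
    by move=> fl fb gE; apply/ltW/sE.
  move=> f g fl fb gE; rewrite !wsumE.
  have h1 := H f g fl fb gE.
  have h2 : wsum s f - wsum s (fun h => f (h * g)%g) <= e / 2.
    have /(_ _ _ gE) := H (fun x => -1 * f x) g.
    rewrite !wsumZ => H'; have : -1 * wsum s (fun h => f (h * g)%g) - -1 * wsum s f <= e / 2.
      apply: H' => [x y|x]; first by rewrite !mulN1r -opprD normrN.
      by rewrite mulN1r normrN.
    lra.
  have h3 : `|wsum s (fun h => f (h * g)%g) - wsum s f| <= e / 2.
    by rewrite ler_norml; apply/andP; split; lra.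
  rewrite (_ : _ - _ = c * (f (d * g)%g - f d) +
    (1 - c) * (wsum s (fun h => f (h * g)%g) - wsum s f)); last by ring.
  apply: le_trans (ler_normD _ _) _; rewrite !normrM (gtr0_norm c0).
  rewrite (@ger0_norm _ (1 - c)) ?subr_ge0//.
  have h4 : `|f (d * g)%g - f d| <= 2.
    by apply: le_trans (ler_normB _ _) _; have := fb (d * g)%g; have := fb d; lra.
  have h5 : c * `|f (d * g)%g - f d| <= c * 2 by rewrite ler_wpM2l// ltW.
  have : (1 - c) * `|wsum s (fun h => f (h * g)%g) - wsum s f| <= e / 2.
    by apply: le_trans h3; rewrite -[leRHS]mul1r ler_wpM2r//; lra.
  lra.
Qed.

End almost_invariance.

(** * Series of finitely supported probabilities *)

(** The sets with Borel preimage form a sigma-algebra containing the open intervals, which generate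
    the Borel sets of [R]. *)
Lemma continuous_preimage_borel (R : realType) (Y : topologicalType) (f : Y -> R)
    (B : set R) : continuous f -> measurable B -> <<s @open Y >> (f @^-1` B).
Proof.
move=> cf mB; pose M : set (set R) := [set A | <<s @open Y >> (f @^-1` A)].
suff : <<s @RGenOpens.G R >> `<=` M.
  by apply; rewrite -[X in X B]RGenOpens.measurableE.
apply: smallest_sub; last first.
  move=> _ [x [y ->]]; apply: sub_sigma_algebra.
  by apply: open_comp (@interval_open R (BRight x) (BLeft y) isT isT) => z _; exact: cf.
have [s0 sC sU] : sigma_algebra setT <<s @open Y >> by exact: smallest_sigma_algebra.
split.
- by rewrite /M/= preimage_set0.
- by move=> A; rewrite /M/= setTD => /sC; rewrite setTD.
- by move=> A mA; rewrite /M/= preimage_bigcup; apply: sU => n; exact: mA.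
Qed.

Section borel_group.
Context {R : realType} {G : topGroupType}.

Lemma continuous_borel_measurable (f : G -> R) : continuous f ->
  measurable_fun setT (f : borelType G -> R).
Proof. by move=> cf _ B mB; rewrite setTI; exact: continuous_preimage_borel. Qed.

Section weighted_series.
Variable a : nat -> seq (R * G).
Hypothesis a_weight : forall i, is_weight (a i).

Let t i : R := 2^-1 ^+ i.+1.

Let t_ge0 i : 0 <= t i. Proof. by rewrite exprn_ge0// invr_ge0. Qed.

Lemma sum_half n : \sum_(i < n) (2^-1 : R) ^+ i.+1 = 1 - 2^-1 ^+ n.
Proof.
elim: n => [|n IH]; first by rewrite big_ord0 expr0 subrr.
by rewrite big_ord_recr/= IH exprS; field.
Qed.

Definition atom i j : R * G := nth (0, 1%g) (a i) j.

(** [mscale] takes a number that is nonnegative by type, so each mass enters through its absolute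
    value, which [a_weight] identifies with the mass. *)
Definition weight_measure i : set (borelType G) -> \bar R :=
  msum (fun j => mscale `|(atom i j).1|%:nng \d_((atom i j).2 : borelType G))
    (size (a i)).

HB.instance Definition _ i := Measure.on (weight_measure i).

Definition weight_series : set (borelType G) -> \bar R :=
  mseries (fun i => mscale (NngNum (t_ge0 i)) (weight_measure i)) 0.

HB.instance Definition _ := Measure.on weight_series.

Lemma weight_measureE i A : weight_measure i A = (wsum (a i) \1_A)%:E.
Proof.
rewrite /weight_measure /msum /wsum (big_nth (0, 1%g)) big_mkord -sumEFin.
apply: eq_bigr => j _; rewrite /mscale /dirac EFinM; congr (_%:E * _)%E.
by apply: ger0_norm; case: (a_weight i) => + _; apply; exact: mem_nth.
Qed.

Lemma weight_seriesE A :
  weight_series A = (\sum_(0 <= i <oo) (t i * wsum (a i) \1_A)%:E)%E.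
Proof.
rewrite /weight_series /mseries; apply: eq_eseriesr => i _.
by rewrite -[LHS]/((t i)%:E * weight_measure i A)%E weight_measureE.
Qed.

Let wsum_ge0 i f : (forall x, 0 <= f x) -> 0 <= wsum (a i) f.
Proof.
move=> f0; rewrite /wsum big_seq; apply: sumr_ge0 => p pa.
by rewrite mulr_ge0//; case: (a_weight i) => + _; exact.
Qed.

Lemma weight_seriesT : weight_series setT = 1%E.
Proof.
rewrite weight_seriesE; apply/cvg_lim => //.
rewrite (_ : (fun n => _) = EFin \o (fun n => 1 - 2^-1 ^+ n : R)).
  apply: cvg_EFin; first exact: nearW.
  rewrite -[X in _ --> X]subr0; apply: cvgB; first exact: cvg_cst.
  by apply: cvg_expr; rewrite ger0_norm ?invr_ge0// invf_lt1// ltr1n.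
apply/funext => n; rewrite sumEFin/= -sum_half big_mkord; congr (_%:E).
apply: eq_bigr => i _; rewrite (_ : \1_setT = fun=> 1) ?wsum_cst ?mulr1//.
by apply/funext => x; rewrite indicT.
Qed.

HB.instance Definition _ := Measure_isProbability.Build _ _ _ weight_series
  weight_seriesT.

Definition weight_probability : probability (borelType G) R := weight_series.

Let le_term A B : A `<=` B -> forall i, t i * wsum (a i) \1_A <= t i * wsum (a i) \1_B.
Proof.
move=> AB i; rewrite ler_wpM2l// -subr_ge0 -wsumB; apply: wsum_ge0 => x.
rewrite subr_ge0 !indicE ler_nat; case: (boolP (x \in A)) => // /set_mem/AB xB.
by rewrite mem_set.
Qed.

Let term_ge0 A i : (0 <= (t i * wsum (a i) \1_A)%:E)%E.
Proof. by rewrite lee_fin mulr_ge0// wsum_ge0// => x; rewrite indicE. Qed.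

(** The first [n] weights have their atoms in a finite set [F], so the [n]-th partial sum for [B] is
    at most the measure of the finite, hence compact, set [B] intersected with [F]. *)
Lemma weight_probability_regular : regular_measure weight_probability.
Proof.
move=> B _; apply/eqP; rewrite eq_le; apply/andP; split; last first.
  apply: ge_ereal_sup => _ [K [_ KB] <-]; rewrite /= !weight_seriesE.
  by apply: lee_nneseries => i *; [exact: term_ge0|rewrite lee_fin; exact: le_term].
rewrite [leLHS]weight_seriesE; apply: lime_le.
  by apply: is_cvg_nneseries => n _ _; exact: term_ge0.
apply: nearW => n; pose F := [set` [seq p.2 | p <- flatten [seq a i | i <- iota 0 n]]].
apply: le_trans (_ : (weight_series (B `&` F) <= _)%E); last first.
  apply: ereal_sup_ubound; exists (B `&` F) => //; split; last exact: subIsetl.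
  by apply: finite_compact; apply: finite_setIr; exact: finite_seq.
rewrite weight_seriesE.
apply: le_trans (nneseries_lim_ge n (fun i _ _ => term_ge0 (B `&` F) i)).
rewrite !big_mkord; apply: lee_sum => i _; rewrite lee_fin ler_wpM2l//.
rewrite le_eqVlt; apply/orP; left; apply/eqP; rewrite /wsum big_seq [RHS]big_seq.
apply: eq_bigr => p pa; congr (_ * _); rewrite !indicE; congr (_%:R : R).
have Fp : F p.2.
  apply/mapP; exists p => //; apply/flattenP; exists (a i) => //.
  by apply/mapP; exists (val i) => //; rewrite mem_iota/=.
by congr nat_of_bool; apply/idP/idP; rewrite !inE => // -[].
Qed.

Lemma weight_probability_spt i c d : 0 < c -> (c, d) \in a i ->
  spt weight_probability d.
Proof.
move=> c0 ai U _ Ud; rewrite [ltRHS]weight_seriesE.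
apply: lt_le_trans (nneseries_lim_ge i.+1 (fun i _ _ => term_ge0 U i)).
rewrite big_nat_recr//=; apply: lt_le_trans (leeDr _ _); last first.
  by apply: sume_ge0 => j _; exact: term_ge0.
rewrite lte_fin mulr_gt0 ?exprn_gt0 ?invr_gt0//.
rewrite /wsum (big_rem (c, d))//=; apply: ltr_pwDl.
  by rewrite indicE mem_set// mulr1.
rewrite big_seq; apply: sumr_ge0 => p /mem_rem pa; rewrite indicE mulr_ge0//.
by case: (a_weight i) => + _; exact.
Qed.

Lemma integral_weight_series_ge0 (f : G -> R) : continuous f ->
  (forall x, 0 <= f x) ->
  (\int[weight_series]_x (f x)%:E = \sum_(0 <= i <oo) (t i * wsum (a i) f)%:E)%E.
Proof.
move=> cf f0; have mf : measurable_fun setT (fun x : borelType G => (f x)%:E).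
  by apply/measurable_EFinP; exact: continuous_borel_measurable.
rewrite ge0_integral_measure_series//; last by move=> x _; rewrite lee_fin.
apply: eq_eseriesr => i _.
rewrite ge0_integral_mscale//; last by move=> x _; rewrite lee_fin.
rewrite ge0_integral_measure_sum//; last by move=> x _; rewrite lee_fin.
rewrite EFinM; congr (_ * _)%E.
rewrite /wsum (big_nth (0, 1%g)) big_mkord -sumEFin; apply: eq_bigr => j _.
rewrite ge0_integral_mscale//; last by move=> x _; rewrite lee_fin.
rewrite integral_dirac// diracT mul1e EFinM; congr (_%:E * _)%E.
by apply: ger0_norm; case: (a_weight i) => + _; apply; exact: mem_nth.
Qed.

(** Adding [M] reduces to nonnegative functions, integrated term by term; the shift contributes
    [(1 - 2^-n) * M] to the [n]-th partial sum. *)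
Lemma integral_weight_probability (f : G -> R) (M r : R) : continuous f ->
  (forall x, `|f x| <= M) ->
  (\int[weight_probability]_x (f x)%:E = r%:E)%E ->
  (fun n => \sum_(i < n) t i * wsum (a i) f) @ \oo --> r.
Proof.
move=> cf fM fr.
have mf : measurable_fun setT (f : borelType G -> R).
  exact: continuous_borel_measurable.
have cg : continuous (fun x => f x + M) by move=> x; apply: cvgD; [exact: cf|exact: cvg_cst].
have g0 x : 0 <= f x + M by have := fM x; rewrite ler_norml; lra.
have : (\int[weight_probability]_x (f x + M)%:E = (r + M)%:E)%E.
  under eq_integral do rewrite EFinD.
  rewrite integralD//=.
  - rewrite fr; rewrite integral_cst//.
    by rewrite -[X in (_ + _ * X)%E]/(weight_series setT) weight_seriesT mule1.
  - apply: measurable_bounded_integrable => //.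
      by rewrite -[X in (X < _)%E]/(weight_series setT) weight_seriesT ltry.
    exists M; split; first exact: num_real.
    by move=> x Mx y _; apply: le_trans (fM y) _; exact: ltW.
  - exact: finite_measure_integrable_cst.
rewrite [X in X = _](integral_weight_series_ge0 cg g0) => S.
have : (fun n => \sum_(0 <= i < n) (t i * wsum (a i) (fun x => f x + M))%:E)%E @ \oo
    --> (r + M)%:E.
  rewrite -S; apply: is_cvg_nneseries => i _ _.
  by rewrite lee_fin mulr_ge0// wsum_ge0.
under eq_cvg do rewrite sumEFin big_mkord.
move=> /fine_cvgP[_] /=; rewrite -[X in X @ _]/(fun n => _) => H.
have -> : (fun n => \sum_(i < n) t i * wsum (a i) f) =
    (fun n => \sum_(i < n) t i * wsum (a i) (fun x => f x + M) - (1 - 2^-1 ^+ n) * M).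
  apply/funext => n; rewrite -sum_half mulr_suml -sumrB; apply: eq_bigr => i _.
  by rewrite wsumD wsum_cst// mulrDr addrK.
have -> : r = (r + M) - (1 - 0) * M by ring.
apply: cvgB => //; apply: cvgMl; apply: cvgB; first exact: cvg_cst.
by apply: cvg_expr; rewrite ger0_norm ?invr_ge0// invf_lt1// ltr1n.
Qed.

End weighted_series.

End borel_group.

(** * The Kaimanovich-Vershik measure *)

Section kaimanovich_vershik.
Context {R : realType} {G : topGroupType}.

(** Its [j]-th iterate on [L] lists the words of [j] letters from [S] followed by an element of
    [L]. *)
Definition translates (S L : seq G) : seq G := [seq (h * l)%g | h <- S, l <- L].

Definition supports (l : seq (seq (R * G))) : seq G :=
  flatten [seq [seq p.2 | p <- s] | s <- l].

(* The word length 4 ^ m is chosen to make (1 - 2^-m) ^ (4 ^ m) tend to 0, see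
   [expr_half_le]. *)
Lemma almost_invariant_sequence (rho : G -> G -> R) (d : nat -> G) :
  amenable R G -> left_pseudometric rho ->
  exists a : nat -> seq (R * G), forall i,
    [/\ is_weight (a i), exists2 c, 0 < c & (c, d i) \in a i &
      forall m j f g, (m <= i)%N -> (j < 4 ^ m)%N ->
        lip rho 1 f -> (forall x, `|f x| <= 1) ->
        g \in iter j (translates (supports (mkseq a m))) (mkseq d m.+1) ->
        `|wsum (a i) (fun h => f (h * g)%g) - wsum (a i) f| <= 2^-1 ^+ i].
Proof.
move=> amG rhoP.
have /choice[pick pickP] : forall q : nat * seq G, exists s : seq (R * G),
    [/\ is_weight s, exists2 c, 0 < c & (c, d q.1) \in s &
      forall f g, lip rho 1 f -> (forall x, `|f x| <= 1) ->
      g \in q.2 -> `|wsum s (fun h => f (h * g)%g) - wsum s f| <= 2^-1 ^+ q.1].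
  by move=> q; apply: charging_almost_invariant_weight => //; rewrite exprn_gt0 ?invr_gt0.
(* All words for which the [i]-th weight must be almost invariant, for every [m <= i], computed from
   the list [l] of its predecessors. *)
pose E i (l : seq (seq (R * G))) := flatten [seq
  flatten [seq iter j (translates (supports (take m l))) (mkseq d m.+1)
          | j <- iota 0 (4 ^ m)] | m <- iota 0 i.+1].
(* Course-of-values recursion: [hist n] is the list of the first [n] weights. *)
pose hist := fix hist n :=
  if n is k.+1 then rcons (hist k) (pick (k, E k (hist k))) else [::].
pose a i := pick (i, E i (hist i)).
have histE n : hist n = mkseq a n.
  by elim: n => //= n IH; rewrite mkseqS -IH.
exists a => i; have [/= ? ? inv] := pickP (i, E i (hist i)).
split=> // m j f g mi jm fl fb gL; apply: inv => //.
apply/flattenP; eexists; first by apply/mapP; exists m; rewrite ?mem_iota.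
apply/flattenP; eexists; first by apply/mapP; exists j; rewrite ?mem_iota.
by rewrite histE /mkseq -map_take take_iota (minn_idPl mi).
Qed.

(** Induction on [n], because [(1 - x) * (1 + (n + 1) * x) <= 1 + n * x]. *)
Lemma expr_1B_le (x : R) n : 0 <= x <= 1 -> (1 - x) ^+ n * (1 + n%:R * x) <= 1.
Proof.
move=> /andP[x0 x1]; elim: n => [|n IH]; first by rewrite expr0; lra.
apply: le_trans IH; rewrite exprSr -mulrA; apply: ler_wpM2l.
  by rewrite exprn_ge0// subr_ge0.
have -> : (1 - x) * (1 + n.+1%:R * x) = 1 + n%:R * x - n.+1%:R * x ^+ 2.
  by rewrite -natr1; ring.
by rewrite gerBl mulr_ge0// sqr_ge0.
Qed.

(** [expr_1B_le] at [x = 2^-n] with exponent [4 ^ n]: the second factor is [1 + 2 ^ n]. *)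
Lemma expr_half_le n : (1 - (2^-1 : R) ^+ n) ^+ (4 ^ n) <= 2^-1 ^+ n.
Proof.
have p0 : 0 < (2 : R) ^+ n by rewrite exprn_gt0.
have := @expr_1B_le (2^-1 ^+ n) (4 ^ n).
rewrite exprn_ge0 ?invr_ge0// exprn_ile1 ?invr_ge0// ?invf_le1// ?ler1n// => /(_ isT).
have -> : (4 ^ n)%:R * (2^-1 : R) ^+ n = 2 ^+ n.
  by rewrite -[4%N]/(2 ^ 2)%N -expnM mulnC expnM natrX natrX exprVn expr2 mulfK ?gt_eqF.
move=> H; rewrite [leRHS]exprVn -[leRHS]div1r ler_pdivlMr//.
apply: le_trans H; apply: ler_wpM2l; last by rewrite lerDr.
by rewrite exprn_ge0// subr_ge0 exprn_ile1 ?invr_ge0// invf_le1// ler1n.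
Qed.

(** * Contraction along the random walk *)

Section contraction.
Variables (rho : G -> G -> R) (d : nat -> G) (a : nat -> seq (R * G)).
Hypothesis a_weight : forall i, is_weight (a i).
Variables (f : G -> R) (M e : R) (m : nat).
Hypothesis fM : forall x, `|f x| <= M.
Let t i : R := 2^-1 ^+ i.+1.
(** The share of the first [n] weights in the average of [f] over one step from [w]; [f_cvg] is then
    harmonicity. *)
Let V n w := \sum_(i < n) t i * wsum (a i) (fun h => f (h * w)%g).
Hypothesis f_cvg : forall w, V ^~ w @ \oo --> f w.
Let L j := iter j (translates (supports (mkseq a m))) (mkseq d m.+1).
Hypothesis a_inv : forall i j w, (m <= i)%N -> (j < 4 ^ m)%N -> w \in L j ->
  `|wsum (a i) (fun h => f (h * w)%g) - wsum (a i) f| <= e.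

Let q : R := 2^-1 ^+ m.
Let q_gt0 : 0 < q. Proof. by rewrite exprn_gt0// invr_gt0. Qed.
Let t_ge0 i : 0 <= t i. Proof. by rewrite exprn_ge0// invr_ge0. Qed.

Let VS n w : V n.+1 w = V n w + t n * wsum (a n) (fun h => f (h * w)%g).
Proof. exact: big_ord_recr. Qed.

Let rest w := f w - V m w.

(** Each term with [i >= m] varies by at most [t i * e], and these [t i] add up to [q]. The
    comparison is with [1%g] because [a_inv] compares with the untranslated [f]. *)
Lemma rest_almost_invariant j w : (j < 4 ^ m)%N -> w \in L j ->
  `|rest w - rest 1%g| <= q * e.
Proof.
move=> jm wL.
have e0 : 0 <= e by apply: le_trans (a_inv (leqnn m) jm wL).
(* [q - 2^-(m + k)] is the sum of the [t i] for [m <= i < m + k]. *)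
have bound k : `|V (m + k)%N w - V (m + k)%N 1%g - (V m w - V m 1%g)| <=
    (q - 2^-1 ^+ (m + k)) * e.
  elim: k => [|k IH]; first by rewrite addn0 !subrr normr0 mul0r.
  have w1 : wsum (a (m + k)%N) (fun h => f (h * 1)%g) = wsum (a (m + k)%N) f.
    by congr wsum; apply/funext => h; rewrite mulg1.
  rewrite addnS !VS w1; set x := wsum _ _; set y := wsum _ _.
  rewrite (_ : _ - _ = V (m + k)%N w - V (m + k)%N 1%g - (V m w - V m 1%g) +
    t (m + k)%N * (x - y)); last by ring.
  apply: le_trans (ler_normD _ _) _.
  have : `|t (m + k)%N * (x - y)| <= t (m + k)%N * e.
    rewrite normrM (ger0_norm (t_ge0 _)) ler_wpM2l//.
    by apply: a_inv jm wL; rewrite leq_addr.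
  rewrite /t exprS; move: IH; set z := _ ^+ (m + k); lra.
rewrite (_ : _ - _ = f w - f 1%g - (V m w - V m 1%g)); last by rewrite /rest; ring.
have C : (fun n => `|V n w - V n 1%g - (V m w - V m 1%g)|) @ \oo -->
    `|f w - f 1%g - (V m w - V m 1%g)|.
  apply: cvg_norm; apply: cvgB; last exact: cvg_cst.
  by apply: cvgB; exact: f_cvg.
apply: (closed_cvg (fun r => r <= q * e)) C; first exact: closed_le.
exists m => // n /= /subnKC <-; apply: le_trans (bound _) _.
by rewrite ler_wpM2r// gerBl exprn_ge0// invr_ge0.
Qed.

(** The average of [f] over the normalized tail of the measure: the constant that [f] is shown to be
    close to. *)
Let c := q^-1 * rest 1%g.
Let u w := f w - c.

Let c_le : `|c| <= M.
Proof.
rewrite /c normrM (gtr0_norm (_ : 0 < q^-1)) ?invr_gt0// ler_pdivrMl//.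
have C : (fun n => `|V n 1%g - V m 1%g|) @ \oo --> `|rest 1%g|.
  by apply: cvg_norm; apply: cvgB; [exact: f_cvg|exact: cvg_cst].
apply: (closed_cvg (fun r => r <= q * M)) C; first exact: closed_le.
have M0 : 0 <= M by apply: le_trans (fM 1%g).
exists m => // n /= /subnKC <-; set k := (n - m)%N.
apply: le_trans (_ : (q - 2^-1 ^+ (m + k)) * M <= _); last first.
  by rewrite ler_wpM2r// gerBl exprn_ge0// invr_ge0.
elim: k => [|k IH]; first by rewrite addn0 !subrr normr0 mul0r.
rewrite addnS VS addrAC; apply: le_trans (ler_normD _ _) _.
have : `|t (m + k)%N * wsum (a (m + k)%N) (fun h => f (h * 1)%g)| <= t (m + k)%N * M.
  by rewrite normrM (ger0_norm (t_ge0 _)) ler_wpM2l// wsum_norm_le.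
rewrite /t exprS; move: IH; set z := _ ^+ (m + k); lra.
Qed.

(** One step of the walk: with mass [1 - q] a weight with [i < m] is drawn, and the word becomes one
    letter longer; with mass [q] the tail is drawn, which contributes [c] up to the error [q * e]. A
    bound [B] on longer words thus yields [(1 - q) * B + q * e]. The condition on [j + k] keeps all
    words within the range of [a_inv]. *)
Lemma contraction k j w : (j + k <= 4 ^ m)%N -> w \in L j ->
  `|u w| <= (1 - q) ^+ k * (2 * M) + e.
Proof.
elim: k j w => [|k IH] j w jk wL.
  have e0 : 0 <= e.
    have d0L : d 0%N \in L 0 by apply/mapP; exists 0%N; rewrite ?mem_iota.
    by apply: le_trans (a_inv (leqnn m) _ d0L); rewrite ?expn_gt0.
  rewrite expr0 mul1r; apply: le_trans (ler_normB _ _) _.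
  by have := fM w; have := c_le; lra.
rewrite addnS in jk.
have -> : u w = \sum_(i < m) t i * wsum (a i) (fun h => u (h * w)%g) +
    (rest w - rest 1%g).
  have -> : \sum_(i < m) t i * wsum (a i) (fun h => u (h * w)%g) = V m w - (1 - q) * c.
    rewrite /V /q -sum_half mulr_suml -sumrB; apply: eq_bigr => i _.
    by rewrite /u wsumB wsum_cst// mulrBr.
  have -> : rest 1%g = q * c by rewrite /c mulVKf// gt_eqF.
  by rewrite /u /rest; ring.
apply: le_trans (ler_normD _ _) _.
have h1 := rest_almost_invariant (leq_ltn_trans (leq_addr k j) jk) wL.
suff : `|\sum_(i < m) t i * wsum (a i) (fun h => u (h * w)%g)| <=
    (1 - q) * ((1 - q) ^+ k * (2 * M) + e).
  by rewrite exprS; move: h1; lra.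
have {}IH p : (p * w)%g \in L j.+1 -> `|u (p * w)%g| <= (1 - q) ^+ k * (2 * M) + e.
  by apply: IH; rewrite addSn.
set B := _ + e in IH *.
apply: le_trans (ler_norm_sum _ _ _) _.
rewrite -[in leRHS]sum_half mulr_suml; apply: ler_sum => i _.
rewrite normrM (ger0_norm (t_ge0 _)) ler_wpM2l//.
apply: wsum_norm_le => // p pa; apply: IH.
apply/allpairsP; exists (p.2, w); split=> //=.
apply/flattenP; exists [seq p.2 | p <- a i]; last exact: map_f.
by apply/mapP; exists (a i) => //; apply/mapP; exists (val i); rewrite ?mem_iota/=.
Qed.

(** The contraction runs for [4 ^ m] steps from the words [d 0], ..., [d m] of length 0; the factor
    [(1 - q) ^ (4 ^ m)] that remains is at most [q]. *)
Lemma almost_constant i k : (i <= m)%N -> (k <= m)%N ->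
  `|f (d i) - f (d k)| <= q * (4 * M) + 2 * e.
Proof.
move=> im km.
have dL j : (j <= m)%N -> d j \in L 0.
  by move=> jm; apply/mapP; exists j; rewrite ?mem_iota.
have H j : (j <= m)%N -> `|f (d j) - c| <= q * (2 * M) + e.
  move=> /dL /(contraction (leqnn (0 + 4 ^ m))); move/le_trans; apply.
  rewrite lerD2r ler_wpM2r ?expr_half_le// mulr_ge0//.
  by apply: le_trans (fM 1%g).
rewrite (_ : f (d i) - _ = (f (d i) - c) - (f (d k) - c)); last by ring.
by apply: le_trans (ler_normB _ _) _; have := H _ im; have := H _ km; lra.
Qed.

End contraction.

Lemma amenable_liouville_measure (rho : G -> G -> R) (d : nat -> G) :
  amenable R G -> left_pseudometric rho -> dense (range d) ->
  exists mu : probability (borelType G) R,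
    [/\ non_degenerate mu, regular_measure mu &
      forall (f : G -> R) (M : R), rho_unif_continuous rho f -> (forall x, `|f x| <= M) ->
        (forall w, (\int[mu]_h (f (h * w)%g)%:E)%E = (f w)%:E) ->
        forall x y, f x = f y].
Proof.
move=> amG rhoP dd.
have [a aP] := almost_invariant_sequence d amG rhoP.
have aw i : is_weight (a i) by case: (aP i).
exists (weight_probability aw); split.
- have ds : range d `<=` generated_subsemigroup (spt (weight_probability aw)).
    move=> _ [i _ <-] S [_ sS]; apply: sS.
    by have [_ [c c0 ca] _] := aP i; exact: weight_probability_spt ca.
  by move=> O O0 oO; have [x [Ox dx]] := dd O O0 oO; exists x; split=> //; exact: ds.
- exact: weight_probability_regular.
- move=> f M fu fM fh.
  have cf : continuous f.
    exact/left_unif_continuous_continuous/(rho_left_unif_continuous rhoP).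
  have f_cvg w : (fun n => \sum_(i < n) 2^-1 ^+ i.+1 *
      wsum (a i) (fun h => f (h * w)%g)) @ \oo --> f w.
    apply: (integral_weight_probability (M := M) _ _ (fh w)) => //.
    move=> h; apply: continuous_comp; last exact: cf.
    have := @mulg2_continuous G 1%g w h; congr continuous_at.
    by apply/funext => x; rewrite mul1g.
  have fd i k : f (d i) = f (d k).
    apply/eqP; rewrite -subr_eq0 -normr_le0; apply/ler_addgt0Pl => e' e'0.
    (* The final error is [2^-m * (4 * M) + 2 * (2 * e + 2^-m * K)], whose terms in [2^-m] add up to
       at most [e] for large [m]. *)
    rewrite addr0; pose e := e' / 5; have e0 : 0 < e by rewrite divr_gt0.
    have [r r0 fr] := fu _ e0.
    have [g [gl gM fg]] := lip_approx rhoP r0 (ltW e0) fM fr.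
    have M0 : 0 <= M by apply: le_trans (fM 1%g).
    set L := 2 * M / r in gl.
    have L0 : 0 <= L by rewrite divr_ge0 ?mulr_ge0// ltW.
    (* Dividing by [K] makes the approximation [g] both 1-Lipschitz and bounded by 1. *)
    pose K := L + M + 1.
    have K0 : 0 < K by rewrite /K; lra.
    have g1l : lip rho 1 (fun x => K^-1 * g x).
      move=> x y; rewrite -mulrBr normrM gtr0_norm ?invr_gt0// ler_pdivrMl// mul1r.
      by apply: le_trans (gl x y) _; rewrite ler_wpM2r ?pdist_ge0// /K; lra.
    have g1b x : `|K^-1 * g x| <= 1.
      rewrite normrM gtr0_norm ?invr_gt0// ler_pdivrMl// mulr1.
      by apply: le_trans (gM x) _; rewrite /K; lra.
    have small (C : R) : 0 < C -> \forall n \near \oo, (2^-1 : R) ^+ n * C <= e.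
      move=> C0; have : (fun n => (2^-1 : R) ^+ n) @ \oo --> (0 : R).
        by apply: cvg_expr; rewrite ger0_norm ?invr_ge0// invf_lt1// ltr1n.
      move=> /cvgr0_norm_le /(_ (e / C)); rewrite divr_gt0// => /(_ isT).
      apply: filterS => n; rewrite ger0_norm ?exprn_ge0 ?invr_ge0//.
      by rewrite ler_pdivlMr.
    near \oo => m.
    (* The term [2 * e] pays for replacing [f] by [g] on both sides, and [2^-m * K] for the almost
       invariance of the rescaled [g]. *)
    have a_inv i0 j w : (m <= i0)%N -> (j < 4 ^ m)%N ->
        w \in iter j (translates (supports (mkseq a m))) (mkseq d m.+1) ->
        `|wsum (a i0) (fun h => f (h * w)%g) - wsum (a i0) f| <= 2 * e + 2^-1 ^+ m * K.
      move=> mi jm wL; have [_ _ /(_ m j _ w mi jm g1l g1b wL)] := aP i0.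
      rewrite !wsumZ -mulrBr normrM gtr0_norm ?invr_gt0// ler_pdivrMl// => H.
      have {}H : `|wsum (a i0) (fun h => g (h * w)%g) - wsum (a i0) g| <= 2^-1 ^+ m * K.
        apply: le_trans H _; rewrite mulrC ler_pM2r//.
        by apply: ler_wiXn2l mi; rewrite ?invr_ge0// invf_le1// ler1n.
      have h1 : `|wsum (a i0) (fun h => f (h * w)%g) - wsum (a i0) (fun h => g (h * w)%g)| <= e.
        by rewrite -wsumB; apply: wsum_norm_le => // p _; exact: fg.
      have h2 : `|wsum (a i0) f - wsum (a i0) g| <= e.
        by rewrite -wsumB; apply: wsum_norm_le => // p _; exact: fg.
      move: H h1 h2; rewrite !ler_norml; lra.
    have := almost_constant aw fM f_cvg a_inv (_ : (i <= m)%N) (_ : (k <= m)%N).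
    move=> /(_ _ _)/le_trans; apply.
    - by near: m; exact: nbhs_infty_ge.
    - by near: m; exact: nbhs_infty_ge.
    have h1 : 2^-1 ^+ m * (4 * M + 2 * K) <= e.
      by near: m; apply: small; lra.
    have -> : e' = 5 * e by rewrite /e; field.
    by move: h1; lra.
  have fdense x : f x = f (d 0%N).
    apply/eqP; rewrite -subr_eq0 -normr_le0; apply/ler_addgt0Pl => e e0.
    rewrite addr0.
    have oO : open [set y | `|f x - f y| < e].
      apply: (@open_comp _ _ (fun y => `|f x - f y|) [set r | r < e]); last exact: open_lt.
      by move=> y _; apply: cvg_norm; apply: cvgB; [exact: cvg_cst|exact: cf].
    have [|y [xy [i _ iy]]] := dd _ _ oO; first by exists x; rewrite /= subrr normr0.
    by rewrite (fd 0%N i) iy ltW.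
  by move=> x y; rewrite fdense [RHS]fdense.
Unshelve. all: by end_near. Qed.

End kaimanovich_vershik.

(** * Convolution and Cesaro means *)

Section convolution.
Context {R : realType} {G : topGroupType}.
Implicit Types (f g : G -> R) (V : set G).

(** Naming [V] and [e] records equicontinuity: one bound serves all iterated convolutions, Cesaro
    means and their limits. *)
Definition oscillation_le V (e : R) f : Prop :=
  forall x y, V (x^-1 * y)%g -> `|f x - f y| <= e.

Definition lucb f : Prop :=
  left_unif_continuous f /\ exists M : R, forall x, `|f x| <= M.

Lemma lucb_cst (c : R) : lucb (fun=> c).
Proof.
split; last by exists `|c|.
by move=> e e0; exists setT; [exact: filterT|move=> *; rewrite subrr normr0 ltW].
Qed.

Lemma lucbZD (a : R) f g : lucb f -> lucb g -> lucb (fun x => a * f x + g x).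
Proof.
move=> [fu [M fM]] [gu [N gN]]; split; first exact: left_unif_continuousZD.
exists (`|a| * M + N) => x; apply: le_trans (ler_normD _ _) _.
by rewrite lerD// normrM ler_wpM2l.
Qed.

Lemma lucb_translate f (g : G) : lucb f -> lucb (fun x => f (x * g)%g).
Proof.
move=> [fu [M fM]]; split=> [e e0|]; last by exists M.
have [U U1 fU] := fu e e0.
exists [set x | U (g^-1 * x * g^-1^-1)%g]; first exact: nbhs1_conj.
by move=> x y /= xyU; apply: fU; rewrite invgM -!mulgA; rewrite invgK -!mulgA in xyU.
Qed.

Variable mu : probability (borelType G) R.

Lemma lucb_integrable f : lucb f ->
  mu.-integrable setT (EFin \o (f : borelType G -> R)).
Proof.
move=> [fu [M fM]]; apply: measurable_bounded_integrable => //.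
- by apply: le_lt_trans (probability_le1 mu measurableT) _; rewrite ltry.
- by apply: continuous_borel_measurable; exact: left_unif_continuous_continuous.
- exists M; split; first exact: num_real.
  by move=> x Mx y _; apply: le_trans (fM y) _; exact: ltW.
Qed.

(** The Markov operator of the walk with steps on the left: bounded harmonic functions are its fixed
    points, and it commutes with right translations. *)
Definition convolve f (w : G) : R := \int[mu]_h (f (h * w)%g).

Lemma convolveZD a f g w : lucb f -> lucb g ->
  convolve (fun x => a * f x + g x) w = a * convolve f w + convolve g w.
Proof.
move=> /(lucb_translate w)/lucb_integrable fi /(lucb_translate w)/lucb_integrable gi.
rewrite /convolve RintegralD//=.
  by rewrite RintegralZl.
by apply: (integrableZl measurableT a fi).
Qed.

Lemma convolve_le f w (e : R) : lucb f -> (forall x, f x <= e) -> convolve f w <= e.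
Proof.
move=> /(lucb_translate w)/lucb_integrable fi fe.
have <- : \int[mu]_(h in setT) e = e.
  rewrite Rintegral_cst// -[X in fine X]/(mu setT) probability_setT.
  by rewrite mulr1.
apply: le_Rintegral => //.
exact: lucb_integrable (lucb_cst e).
Qed.

Lemma convolve_norm_le f w (e : R) : lucb f -> (forall x, `|f x| <= e) ->
  `|convolve f w| <= e.
Proof.
move=> fl fe; rewrite ler_norml convolve_le ?andbT//; last first.
  by move=> x; apply: le_trans (ler_norm _) _.
have := convolveZD (-1) w fl (lucb_cst 0).
rewrite [X in _ = _ + X](_ : _ = 0).
  rewrite addr0 mulN1r lerNl => <-; apply: convolve_le => [|x].
    by apply: lucbZD => //; exact: lucb_cst.
  by rewrite addr0 mulN1r; apply: le_trans (ler_norm _) _; rewrite normrN.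
by rewrite /convolve Rintegral_cst// mul0r.
Qed.

(** Steps on the left leave [x^-1 * y] unchanged. *)
Lemma convolve_oscillation V e f : lucb f -> oscillation_le V e f ->
  oscillation_le V e (convolve f).
Proof.
move=> fl fV x y xyV.
pose k (h : G) := -1 * f (h * y)%g + f (h * x)%g.
have kl : lucb k by apply: lucbZD; exact: lucb_translate.
have -> : convolve f x - convolve f y = convolve k 1%g.
  rewrite [RHS]convolveZD; [|exact: lucb_translate|exact: lucb_translate].
  rewrite mulN1r [RHS]addrC.
  by congr (_ - _); congr Rintegral; apply/funext => h; rewrite mulg1.
apply: convolve_norm_le => // h; rewrite /k mulN1r addrC; apply: fV.
by rewrite invgM -mulgA mulKg.
Qed.

Lemma convolve_lucb f : lucb f -> lucb (convolve f).
Proof.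
move=> fl; have [fu [M fM]] := fl; split; last first.
  by exists M => x; exact: convolve_norm_le.
by move=> e e0; have [U U1 fU] := fu e e0; exists U => //; exact: convolve_oscillation.
Qed.

Definition iter_convolve n f := iter n convolve f.

Definition cesaro_mean n f (w : G) : R :=
  n.+1%:R^-1 * \sum_(k < n.+1) iter_convolve k f w.

Lemma iter_convolve_lucb n f : lucb f -> lucb (iter_convolve n f).
Proof. by move=> fl; elim: n => //= n; exact: convolve_lucb. Qed.

Lemma iter_convolve_norm_le n f e : lucb f -> (forall x, `|f x| <= e) ->
  forall x, `|iter_convolve n f x| <= e.
Proof.
move=> fl fe; elim: n => //= n IH x; apply: convolve_norm_le => //.
exact: iter_convolve_lucb.
Qed.

Lemma iter_convolve_ge0 n f : lucb f -> (forall x, 0 <= f x) ->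
  forall x, 0 <= iter_convolve n f x.
Proof.
by move=> fl fe; elim: n => //= n IH x; exact: Rintegral_ge0.
Qed.

Lemma iter_convolve_oscillation n V e f : lucb f -> oscillation_le V e f ->
  oscillation_le V e (iter_convolve n f).
Proof.
move=> fl fe; elim: n => //= n IH; apply: convolve_oscillation => //.
exact: iter_convolve_lucb.
Qed.

Lemma iter_convolveZD n a f g w : lucb f -> lucb g ->
  iter_convolve n (fun x => a * f x + g x) w =
  a * iter_convolve n f w + iter_convolve n g w.
Proof.
move=> fl gl; elim: n w => //= n IH w.
rewrite -convolveZD; [|exact: iter_convolve_lucb|exact: iter_convolve_lucb].
by congr convolve; apply/funext.
Qed.

Lemma iter_convolve_translate n f (g w : G) :
  iter_convolve n (fun x => f (x * g)%g) w = iter_convolve n f (w * g)%g.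
Proof.
elim: n w => //= n IH w; congr Rintegral; apply/funext => h.
by rewrite IH mulgA.
Qed.

Let mean_le n (u : nat -> R) e : (forall k, u k <= e) ->
  n.+1%:R^-1 * \sum_(k < n.+1) u k <= e.
Proof.
move=> ue; rewrite ler_pdivrMl ?ltr0n//.
apply: le_trans (ler_sum _ (_ : forall i, true -> _ <= e)) _ => //.
by rewrite sumr_const card_ord mulr_natl.
Qed.

Lemma mean_norm_le n (u : nat -> R) e : (forall k, `|u k| <= e) ->
  `|n.+1%:R^-1 * \sum_(k < n.+1) u k| <= e.
Proof.
move=> ue; rewrite normrM ger0_norm ?invr_ge0//.
apply: le_trans (mean_le n ue); rewrite ler_wpM2l ?invr_ge0//.
exact: ler_norm_sum.
Qed.

Lemma cesaro_mean_norm_le n f e : lucb f -> (forall x, `|f x| <= e) ->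
  forall x, `|cesaro_mean n f x| <= e.
Proof.
move=> fl fe x; apply: (@mean_norm_le n (fun k => iter_convolve k f x)) => k.
exact: iter_convolve_norm_le.
Qed.

Lemma cesaro_mean_oscillation n V e f : lucb f -> oscillation_le V e f ->
  oscillation_le V e (cesaro_mean n f).
Proof.
move=> fl fe x y xyV; rewrite /cesaro_mean -mulrBr -sumrB.
apply: (@mean_norm_le n (fun k => iter_convolve k f x - iter_convolve k f y)) => k.
exact: iter_convolve_oscillation xyV.
Qed.

Lemma cesaro_mean_lucb n f : lucb f -> lucb (cesaro_mean n f).
Proof.
move=> fl; have [fu [M fM]] := fl; split; last first.
  by exists M => x; exact: cesaro_mean_norm_le.
by move=> e e0; have [U U1 fU] := fu e e0; exists U => //; exact: cesaro_mean_oscillation.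
Qed.

Lemma cesaro_mean_ge0 n f : lucb f -> (forall x, 0 <= f x) -> forall x, 0 <= cesaro_mean n f x.
Proof.
move=> fl fe x; rewrite mulr_ge0 ?invr_ge0// sumr_ge0// => k _.
exact: iter_convolve_ge0.
Qed.

Lemma cesaro_meanZD n a f g w : lucb f -> lucb g ->
  cesaro_mean n (fun x => a * f x + g x) w = a * cesaro_mean n f w + cesaro_mean n g w.
Proof.
move=> fl gl; rewrite /cesaro_mean mulrCA -mulrDr; congr (_ * _).
by rewrite mulr_sumr -big_split/=; apply: eq_bigr => k _; exact: iter_convolveZD.
Qed.

Lemma cesaro_mean_cst n c w : cesaro_mean n (fun=> c) w = c.
Proof.
have H k x : iter_convolve k (fun=> c) x = c.
  elim: k x => //= k IH x; rewrite /convolve.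
  under eq_Rintegral do rewrite IH.
  by rewrite Rintegral_cst// -[X in fine X]/(mu setT) probability_setT mulr1.
rewrite /cesaro_mean (eq_bigr (fun=> c)) => [|k _]; last exact: H.
by rewrite sumr_const card_ord -[c *+ _]mulr_natl mulKf// pnatr_eq0.
Qed.

Lemma cesaro_mean_translate n f (g w : G) :
  cesaro_mean n (fun x => f (x * g)%g) w = cesaro_mean n f (w * g)%g.
Proof.
by congr (_ * _); apply: eq_bigr => k _; exact: iter_convolve_translate.
Qed.

(** Telescoping: convolving shifts the iterates by one, so only the two end terms survive and the
    defect of harmonicity is of order 1/n. *)
Lemma convolve_cesaro_mean n f w : lucb f ->
  convolve (cesaro_mean n f) w =
  cesaro_mean n f w + n.+1%:R^-1 * (iter_convolve n.+1 f w - f w).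
Proof.
move=> fl.
have sumE k : lucb (fun x => \sum_(i < k) iter_convolve i f x) /\
    convolve (fun x => \sum_(i < k) iter_convolve i f x) w =
    \sum_(i < k) iter_convolve i.+1 f w.
  elim: k => [|k [IH1 IH2]].
    have -> : (fun x => \sum_(i < 0) iter_convolve i f x) = fun=> 0.
      by apply/funext => x; rewrite big_ord0.
    split; first exact: lucb_cst.
    by rewrite big_ord0 /convolve Rintegral_cst// mul0r.
  have -> : (fun x => \sum_(i < k.+1) iter_convolve i f x) =
      fun x => 1 * iter_convolve k f x + \sum_(i < k) iter_convolve i f x.
    by apply/funext => x; rewrite big_ord_recr/= mul1r addrC.
  split; first by apply: lucbZD => //; exact: iter_convolve_lucb.
  rewrite convolveZD//; last exact: iter_convolve_lucb.
  by rewrite IH2 big_ord_recr/= mul1r addrC.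
have [S1 S2] := sumE n.+1.
have -> : convolve (cesaro_mean n f) w =
    n.+1%:R^-1 * \sum_(i < n.+1) iter_convolve i.+1 f w.
  rewrite -S2; have := convolveZD n.+1%:R^-1 w S1 (lucb_cst 0).
  have -> : convolve (fun=> 0) w = 0 by rewrite /convolve Rintegral_cst// mul0r.
  by rewrite addr0 => <-; congr convolve; apply/funext => x; rewrite addr0.
rewrite /cesaro_mean -mulrDr; congr (_ * _).
rewrite big_ord_recr [X in _ = X + _]big_ord_recl /=.
rewrite [X in _ = _ + X + _](eq_bigr (fun i : 'I_n => iter_convolve i.+1 f w))//.
by ring.
Qed.

End convolution.

(** * Invariant means from Liouville measures *)

(** Compactness of [[- M, M]] gives a cluster point, and an ultrafilter converges to its cluster
    points. *)
Lemma ultra_cvg_bounded (R : realType) (T : Type) (U : set_system T)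
    (UU : UltraFilter U) (u : T -> R) (M : R) :
  (forall n, `|u n| <= M) -> u @ U --> lim (u @ U).
Proof.
move=> uM; apply/cvg_ex.
have [|p [_ pU]] := @segment_compact R (- M) M (u @ U) _.
  suff : U (u @^-1` `[- M, M]) by [].
  by apply: filterS filterT => n _; rewrite /= in_itv/= -ler_norml.
exists p => B pB; have [//|UB] := in_ultra_setVsetC (u @^-1` B) UU.
by have [x []] := pU (~` B) B UB pB.
Qed.

Lemma cvg_norm_le (R : realType) (T : Type) (F : set_system T) (FF : ProperFilter F)
    (u : T -> R) (l e : R) :
  u @ F --> l -> (\forall n \near F, `|u n| <= e) -> `|l| <= e.
Proof. by move=> /cvg_norm ul; apply: cvgr_to_le. Qed.

Section invariant_mean.
Context {R : realType} {G : topGroupType}.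
Implicit Types (f : G -> R) (m : (G -> R) -> R).

(** As for [state], a total map of which only the values on [lucb] matter. *)
Definition mean m : Prop := [/\
  forall (a : R) f g, lucb f -> lucb g -> m (fun x => a * f x + g x) = a * m f + m g,
  forall f, lucb f -> (forall x, 0 <= f x) -> 0 <= m f &
  m (fun=> 1) = 1].

Lemma mean_le m f (e : R) : mean m -> lucb f -> (forall x, f x <= e) -> m f <= e.
Proof.
move=> [mD m0 m1] fl fe.
have m00 : m (fun=> 0) = 0.
  have := mD (-1) _ _ (lucb_cst 0) (lucb_cst 0).
  by rewrite mulr0 addr0 mulN1r addNr.
have me : m (fun=> e) = e.
  have := mD e _ _ (lucb_cst 1) (lucb_cst 0).
  by rewrite m00 m1 !addr0 mulr1.
have := m0 (fun x => -1 * f x + e).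
rewrite mD ?me//; last exact: lucb_cst.
rewrite mulN1r addrC subr_ge0; apply; first by apply: lucbZD => //; exact: lucb_cst.
by move=> x; rewrite mulN1r addrC subr_ge0.
Qed.

Lemma mean_norm_le_bound m f (e : R) : mean m -> lucb f -> (forall x, `|f x| <= e) ->
  `|m f| <= e.
Proof.
move=> mm fl fe; rewrite ler_norml (mean_le mm fl) ?andbT; last first.
  by move=> x; apply: le_trans (ler_norm _) _.
have [mD m0 m1] := mm.
have m00 : m (fun=> 0) = 0.
  have := mD (-1) _ _ (lucb_cst 0) (lucb_cst 0).
  by rewrite mulr0 addr0 mulN1r addNr.
have := mD (-1) _ _ fl (lucb_cst 0); rewrite m00 addr0 mulN1r lerNl => <-.
apply: (mean_le mm); first by apply: lucbZD => //; exact: lucb_cst.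
by move=> x; rewrite addr0 mulN1r; apply: le_trans (ler_norm _) _; rewrite normrN.
Qed.

(** * Limits of Cesaro means along an ultrafilter *)

Section liouville_mean.
Variables (mu : probability (borelType G) R) (rho : G -> G -> R) (d : nat -> G).
Hypothesis rhoP : left_pseudometric rho.
Hypothesis d_dense : dense (range d).
Hypothesis mu_liouville : forall f (L M : R), lip rho L f -> (forall x, `|f x| <= M) ->
  (forall w, (f w)%:E = (\int[mu]_h (f (h * w)%g)%:E)%E) ->
  exists c, forall x, f x = c.

Variables (U : set_system nat) (UU : UltraFilter U).
Hypothesis U_infty : \oo `<=` U.

Let T f w : R := lim ((fun n => cesaro_mean mu n f w) @ U).

Let T_cvg f w : lucb f -> (fun n => cesaro_mean mu n f w) @ U --> T f w.
Proof.
move=> fl; have [_ [M fM]] := fl.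
by apply: (@ultra_cvg_bounded _ _ _ _ _ M) => n; exact: cesaro_mean_norm_le.
Qed.

Let T_lim f w (l : R) : (fun n => cesaro_mean mu n f w) @ U --> l -> T f w = l.
Proof. exact: cvg_lim. Qed.

Let T_norm_le f e : lucb f -> (forall x, `|f x| <= e) -> forall x, `|T f x| <= e.
Proof.
move=> fl fe x; apply: (cvg_norm_le _ (T_cvg (w := x) fl)).
by apply: nearW => n; exact: cesaro_mean_norm_le.
Qed.

Let T_oscillation V e f : lucb f -> oscillation_le V e f -> oscillation_le V e (T f).
Proof.
move=> fl fe x y xyV.
apply: (cvg_norm_le _ (cvgB (T_cvg (w := x) fl) (T_cvg (w := y) fl))).
by apply: nearW => n; exact: cesaro_mean_oscillation xyV.
Qed.

Let T_lucb f : lucb f -> lucb (T f).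
Proof.
move=> fl; have [fu [M fM]] := fl; split; last by exists M => x; exact: T_norm_le.
by move=> e e0; have [V V1 fV] := fu e e0; exists V => //; exact: T_oscillation.
Qed.

(* Dominated convergence is not available along an ultrafilter; equicontinuity and
   density provide a subsequence with the same limit. *)
Let T_subsequence f : lucb f -> exists n : nat -> nat,
  (forall j, (j <= n j)%N) /\
  forall x, (fun j => cesaro_mean mu (n j) f x) @ \oo --> T f x.
Proof.
move=> fl; have [fu [M fM]] := fl.
(* The [j]-th index is accurate to [1 / (j + 1)] at [d 0], ..., [d j]: finitely many conditions,
   each met on a set of [U]. *)
have /choice[n nP] : forall j, exists k, (j <= k)%N /\
    forall i : 'I_j.+1, `|cesaro_mean mu k f (d i) - T f (d i)| <= j.+1%:R^-1.
  move=> j; apply: (@filter_ex _ U); apply: filterI.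
    by apply: U_infty; exact: nbhs_infty_ge.
  apply: filter_forall => i.
  have /cvgrPdistC_le := T_cvg (w := d i) fl; apply.
  by rewrite invr_gt0.
exists n; split=> [j|x]; first by case: (nP j).
apply/cvgrPdistC_le => e e0; have e30 : 0 < e / 3 by rewrite divr_gt0.
have [V V1 fV] := fu _ e30.
have [i xi] : exists i, V (x^-1 * d i)%g.
  have := nbhs_div x V1; rewrite /prop_near1/= nbhsE => -[W [oW Wx] WV].
  by have [|y [/WV ? [i _ yi]]] := d_dense _ oW; [exists x|exists i; rewrite yi].
have lim0 : (fun j => j.+1%:R^-1 : R) @ \oo --> 0 by exact: cvg_harmonic.
near=> j.
have h1 := cesaro_mean_oscillation mu (n j) fl fV xi.
have h2 := T_oscillation fl fV xi.
have ij : (i < j.+1)%N by near: j; exact: nbhs_infty_ge.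
have [_ /(_ (Ordinal ij))/= h3] := nP j.
have h4 : j.+1%:R^-1 <= e / 3.
  have : `|j.+1%:R^-1 : R| <= e / 3.
    by near: j; have /cvgr0_norm_le := lim0; exact.
  by rewrite ger0_norm// invr_ge0.
move: (le_trans h3 h4) h1 h2; rewrite !ler_norml; lra.
Unshelve. all: by end_near. Qed.

(** Along the subsequence, the convolved Cesaro means converge to [convolve mu (T f) w] by dominated
    convergence, and to [T f w] because their defect of harmonicity vanishes. *)
Let T_harmonic f w : lucb f -> convolve mu (T f) w = T f w.
Proof.
move=> fl; have [fu [M fM]] := fl.
have [n [n_ge n_cvg]] := T_subsequence fl.
have M0 : 0 <= M by apply: le_trans (fM 1%g).
have c1 : (fun j => convolve mu (cesaro_mean mu (n j) f) w) @ \oo --> convolve mu (T f) w.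
  have mlucb g : lucb g -> measurable_fun setT (fun h : borelType G => (g (h * w)%g)%:E).
    move=> gl; apply/measurable_EFinP; apply: continuous_borel_measurable.
    by apply: left_unif_continuous_continuous; case: (lucb_translate w gl).
  have [|||||_ _] := @dominated_convergence _ (borelType G) R mu setT measurableT
    (fun j h => (cesaro_mean mu (n j) f (h * w)%g)%:E) (fun h => (T f (h * w)%g)%:E)
    (cst M%:E).
  - by move=> j; apply: mlucb; exact: cesaro_mean_lucb.
  - by apply: mlucb; exact: T_lucb.
  - apply: aeW => h _; apply: cvg_EFin; first exact: nearW.
    exact: n_cvg.
  - exact: finite_measure_integrable_cst.
  - by apply: aeW => h j _; rewrite lee_fin; exact: cesaro_mean_norm_le.
  have intE g : lucb g -> (\int[mu]_h (g (h * w)%g)%:E = (convolve mu g w)%:E)%E.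
    move=> gl; rewrite /convolve /Rintegral fineK//.
    by apply: integrable_fin_num => //; exact: (lucb_integrable mu (lucb_translate w gl)).
  rewrite intE; last exact: T_lucb.
  move=> /fine_cvgP[_]; apply: cvg_trans; apply: near_eq_cvg; apply: nearW => j /=.
  by rewrite intE//; exact: cesaro_mean_lucb.
have c2 : (fun j => convolve mu (cesaro_mean mu (n j) f) w) @ \oo --> T f w.
  have -> : (fun j => convolve mu (cesaro_mean mu (n j) f) w) =
      (fun j => cesaro_mean mu (n j) f w +
        (n j).+1%:R^-1 * (iter_convolve mu (n j).+1 f w - f w)).
    by apply/funext => j; exact: convolve_cesaro_mean.
  rewrite -[T f w]addr0; apply: cvgD; first exact: n_cvg.
  apply/cvgr0Pnorm_le => e e0.
  have lim0 : (fun j => j.+1%:R^-1 : R) @ \oo --> 0 by exact: cvg_harmonic.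
  have e1 : 0 < e / (2 * M + 1) by rewrite divr_gt0//; lra.
  near=> j.
  have h4 : j.+1%:R^-1 <= e / (2 * M + 1).
    have : `|j.+1%:R^-1 : R| <= e / (2 * M + 1).
      by near: j; have /cvgr0_norm_le := lim0; exact.
    by rewrite ger0_norm// invr_ge0.
  rewrite normrM ger0_norm ?invr_ge0//.
  have h5 : (n j).+1%:R^-1 <= (j.+1%:R^-1 : R).
    by rewrite lef_pV2 ?posrE ?ltr0n// ler_nat ltnS.
  have h6 : `|iter_convolve mu (n j).+1 f w - f w| <= 2 * M + 1.
    apply: le_trans (ler_normB _ _) _.
    have := iter_convolve_norm_le mu (n j).+1 fl fM w.
    by have := fM w; lra.
  have -> : e = e / (2 * M + 1) * (2 * M + 1) by rewrite divfK// gt_eqF//; lra.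
  by apply: ler_pM => //; exact: le_trans h5 h4.
exact: (cvg_unique (@Rhausdorff R) c1 c2).
Unshelve. all: by end_near. Qed.

(** The mean is [T f 1%g]. As [T] commutes with right translations, translating [f] by [g] gives
    [T f g], which is the same value since the harmonic Lipschitz function [T f] is constant. *)
Lemma liouville_mean_exists : exists m, mean m /\
  forall f (L M : R), lip rho L f -> (forall x, `|f x| <= M) ->
    forall g : G, m (fun x => f (x * g)%g) = m f.
Proof.
exists (fun f => T f 1%g); split; first split.
- move=> a f g fl gl; apply: T_lim; under eq_cvg do rewrite cesaro_meanZD//.
  by apply: cvgD; [apply: cvgMr|]; exact: T_cvg.
- move=> f fl f0; apply: (cvgr_to_ge (T_cvg (w := 1%g) fl)).
  by apply: nearW => n; exact: cesaro_mean_ge0.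
- by apply: T_lim; under eq_cvg do rewrite cesaro_mean_cst; exact: cvg_cst.
move=> f L M fL fM g.
have fl : lucb f.
  split; last by exists M.
  exact/(rho_left_unif_continuous rhoP)/(lip_rho_unif_continuous rhoP fL).
have TL : lip rho L (T f).
  (* A singleton in place of a neighbourhood transfers the Lipschitz estimate pair by pair. *)
  move=> x y; have H : oscillation_le [set z | z = (x^-1 * y)%g] (L * rho x y) f.
    move=> x' y' /= xy; apply: le_trans (fL x' y') _.
    by rewrite -(pdist_left rhoP x'^-1%g) mulVg xy -(pdist_left rhoP x^-1%g x) mulVg.
  exact: T_oscillation fl H _ _ erefl.
have [c Tc] : exists c, forall x, T f x = c.
  apply: (mu_liouville TL (T_norm_le fl fM)) => w.
  rewrite -[in LHS](T_harmonic w fl) /convolve /Rintegral fineK//.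
  apply: integrable_fin_num => //.
  exact: (lucb_integrable mu (lucb_translate w (T_lucb fl))).
rewrite [RHS]Tc -(Tc g); apply: T_lim.
have -> : (fun n => cesaro_mean mu n (fun x => f (x * g)%g) 1%g) =
    (fun n => cesaro_mean mu n f g).
  by apply/funext => n; rewrite cesaro_mean_translate mul1g.
exact: T_cvg.
Qed.

End liouville_mean.

Lemma liouville_mean (mu : probability (borelType G) R) (rho : G -> G -> R) (d : nat -> G) :
  left_pseudometric rho -> dense (range d) ->
  (forall f (L M : R), lip rho L f -> (forall x, `|f x| <= M) ->
    (forall w, (f w)%:E = (\int[mu]_h (f (h * w)%g)%:E)%E) ->
    exists c, forall x, f x = c) ->
  exists m, mean m /\
  forall f (L M : R), lip rho L f -> (forall x, `|f x| <= M) ->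
    forall g : G, m (fun x => f (x * g)%g) = m f.
Proof.
move=> rhoP dd muL; have [U [UU oU]] := ultraFilterLemma (@eventually_filter).
exact: (liouville_mean_exists rhoP dd muL UU oU).
Qed.

(** Each [rho i] yields a mean invariant on its Lipschitz functions. A bounded left uniformly
    continuous function is uniformly close to such functions for all large [i], so the ultralimit of
    the means is invariant on it. *)
Lemma amenable_of_liouville (I : Type) (rho : I -> G -> G -> R) (d : nat -> G) :
  I -> dense (range d) -> (forall i, left_pseudometric (rho i)) ->
  (forall i j, exists k, forall x y, rho i x y <= rho k x y /\ rho j x y <= rho k x y) ->
  (forall U : set G, nbhs 1%g U ->
     exists i, exists2 r, 0 < r & forall g, rho i 1%g g < r -> U g) ->
  (forall i, exists mu : probability (borelType G) R,
     forall f (L M : R), lip (rho i) L f -> (forall x, `|f x| <= M) ->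
     (forall w, (f w)%:E = (\int[mu]_h (f (h * w)%g)%:E)%E) ->
     exists c, forall x, f x = c) ->
  amenable R G.
Proof.
move=> i0 dd rhoP rho_dir rho_nbhs rho_liouville.
have /choice[m mP] : forall i, exists m, mean m /\
    forall f (L M : R), lip (rho i) L f -> (forall x, `|f x| <= M) ->
    forall g : G, m (fun x => f (x * g)%g) = m f.
  by move=> i; have [mu muL] := rho_liouville i; exact: (liouville_mean (rhoP i) dd muL).
(* The tails of the directed index set, which form a filter base. *)
pose B i := [set j | forall x y, rho i x y <= rho j x y].
have FB : ProperFilter (filter_from setT B).
  apply: filter_from_proper; last by move=> i _; exists i => x y.
  apply: filter_fromT_filter; first by exists i0.
  move=> i j; have [k ijk] := rho_dir i j; exists k => l kl.
  by split=> x y; apply: le_trans (kl x y); case: (ijk x y).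
have [U [UU BU]] := ultraFilterLemma FB.
pose mm f := lim ((fun i => m i f) @ U).
have mm_cvg f : lucb f -> (fun i => m i f) @ U --> mm f.
  move=> fl; have [_ [M fM]] := fl; apply: (@ultra_cvg_bounded _ _ _ _ _ M) => i.
  by apply: mean_norm_le_bound fM => //; have [] := mP i.
have mmm : mean mm.
  split.
  - move=> a f g fl gl; apply: cvg_lim => //.
    rewrite (_ : (fun i => _) = (fun i => a * m i f + m i g)).
      by apply: cvgD; [apply: cvgMr|]; exact: mm_cvg.
    by apply/funext => i; have [[mD _ _] _] := mP i; exact: mD.
  - move=> f fl f0; apply: (cvgr_to_ge (mm_cvg f fl)).
    by apply: nearW => i; have [[_ mp _] _] := mP i; exact: mp.
  - apply: cvg_lim => //; rewrite (_ : (fun i => _) = fun=> 1); first exact: cvg_cst.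
    by apply/funext => i; have [[]] := mP i.
have mm_inv f g : lucb f -> mm (fun x => f (x * g)%g) = mm f.
  move=> fl; have [fu [M fM]] := fl.
  apply/eqP; rewrite -subr_eq0 -normr_le0; apply/ler_addgt0Pl => e e0; rewrite addr0.
  apply: (cvg_norm_le _ (cvgB (mm_cvg _ (lucb_translate g fl)) (mm_cvg _ fl))).
  have e20 : 0 < e / 2 by rewrite divr_gt0.
  have [V V1 fV] := fu _ e20.
  have [i [r r0 iV]] := rho_nbhs V V1.
  apply: BU; exists i => // j ij.
  have [[mD mp m1] mL] := mP j.
  have fr x y : rho j x y < r -> `|f x - f y| <= e / 2.
    move=> xyr; apply: fV; apply: iV.
    rewrite -(pdist_left (rhoP i) x) mulg1 mulVKg.
    exact: le_lt_trans (ij x y) xyr.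
  have [h [hL hM fh]] := lip_approx (rhoP j) r0 (ltW e20) fM fr.
  have hl : lucb h.
    split; last by exists M.
    exact/(rho_left_unif_continuous (rhoP j))/(lip_rho_unif_continuous (rhoP j) hL).
  have near k l : lucb k -> lucb l -> (forall x, `|k x - l x| <= e / 2) ->
      `|m j k - m j l| <= e / 2.
    move=> kl ll klE; rewrite -[_ - _]addrC -mulN1r -mD//.
    apply: mean_norm_le_bound; [by split|exact: lucbZD|].
    by move=> x; rewrite mulN1r addrC.
  have h1 : `|m j (fun x => f (x * g)%g) - m j (fun x => h (x * g)%g)| <= e / 2.
    by apply: near => //; exact: lucb_translate.
  have h2 : `|m j f - m j h| <= e / 2 by exact: near.
  rewrite (mL h _ _ hL hM g) in h1.
  suff : `|m j (fun x => f (x * g)%g) - m j f| <= e by [].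
  by move: h1 h2; rewrite !ler_norml; lra.
have mm0 : mm (fun=> 0) = 0.
  by apply/eqP; rewrite -normr_le0; apply: (mean_norm_le_bound mmm (lucb_cst 0)) => x;
    rewrite normr0.
have [mmD mm_pos mm1] := mmm.
have RUCB_lucb (p : R[i] -> R) (f : G -> R[i]) : (forall z w, p (z - w) = p z - p w) ->
    (forall z (c : R), `|z| <= c%:C%C -> `|p z| <= c) -> RUCB f ->
    lucb (fun x => p (f x^-1%g)).
  move=> pB p_le [fu [M fM]]; split; last by exists M => x; exact: p_le.
  move=> e e0; have [U0 U1 fU] := fu e e0; exists U0 => // x y xyU.
  by rewrite -pB; apply: p_le; apply: fU; rewrite invgK.
have norm_le (a b c : R) : `|Complex a b| <= c%:C%C -> `|a| <= c /\ `|b| <= c.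
  rewrite normc_def lecR/= => h; split; apply: le_trans h.
    by rewrite -sqrtr_sqr ler_wsqrtr// lerDl sqr_ge0.
  by rewrite -sqrtr_sqr ler_wsqrtr// lerDr sqr_ge0.
have RefL (f : G -> R[i]) : RUCB f -> lucb (fun x => complex.Re (f x^-1%g)).
  by apply: RUCB_lucb => [[a b] [c e]//|[a b] c /norm_le[]].
have ImfL (f : G -> R[i]) : RUCB f -> lucb (fun x => complex.Im (f x^-1%g)).
  by apply: RUCB_lucb => [[a b] [c e]//|[a b] c /norm_le[]].
(* The real mean acts on real and imaginary parts after inversion, which turns right translations
   into left ones. *)
exists (fun f : G -> R[i] => Complex (mm (fun x => complex.Re (f x^-1%g)))
                         (mm (fun x => complex.Im (f x^-1%g)))).
  split.
  - move=> [a b] f1 f2 f1R f2R.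
    have -> : (fun x : G => complex.Re (Complex a b * f1 x^-1%g + f2 x^-1%g)) =
        fun x => a * complex.Re (f1 x^-1%g) +
                 (- b * complex.Im (f1 x^-1%g) + complex.Re (f2 x^-1%g)).
      apply/funext => x; case: (f1 _) => [u v]; case: (f2 _) => [u' v'] /=.
      by rewrite mulNr addrA.
    have -> : (fun x : G => complex.Im (Complex a b * f1 x^-1%g + f2 x^-1%g)) =
        fun x => a * complex.Im (f1 x^-1%g) +
                 (b * complex.Re (f1 x^-1%g) + complex.Im (f2 x^-1%g)).
      apply/funext => x; case: (f1 _) => [u v]; case: (f2 _) => [u' v'] /=.
      by rewrite addrA.
    rewrite !mmD; do ?[exact: RefL|exact: ImfL|apply: lucbZD].
    by apply/eqP; rewrite eq_complex/=; apply/andP; split; apply/eqP; ring.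
  - move=> f fR f0; rewrite lecE/=.
    have [fr fi] : (forall x, 0 <= complex.Re (f x)) /\ (forall x, complex.Im (f x) = 0).
      by split=> x; have := f0 x; rewrite lecE/= => /andP[/eqP].
    rewrite mm_pos ?andbT//; last exact: RefL.
    by rewrite (_ : (fun x => _) = fun=> 0) ?mm0//; apply/funext => x.
  - by rewrite /= mm1 mm0.
move=> f g fR.
have -> : (fun x => complex.Re (f (g * x^-1)%g)) =
    (fun x => (fun y => complex.Re (f y^-1%g)) (x * g^-1)%g).
  by apply/funext => x; rewrite invgM invgK.
have -> : (fun x => complex.Im (f (g * x^-1)%g)) =
    (fun x => (fun y => complex.Im (f y^-1%g)) (x * g^-1)%g).
  by apply/funext => x; rewrite invgM invgK.
congr Complex.
  exact: (mm_inv _ g^-1%g (RefL _ fR)).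
exact: (mm_inv _ g^-1%g (ImfL _ fR)).
Qed.

End invariant_mean.

(** * Orbit pseudometrics *)

Lemma dense_mdist (R : realType) (X : metricType R) (D : set X) (x : X) (e : R) :
  dense D -> 0 < e -> exists2 a, D a & mdist x a < e.
Proof.
move=> dD e0.
have : nbhs x [set y | mdist x y < e].
  by rewrite -metricType_numDomainType.filter_from_mdist_nbhs; exists e.
rewrite nbhsE => -[W [oW Wx] WU].
by have [|a [/WU ? ?]] := dD W _ oW; [exists x|exists a].
Qed.

Lemma unif_continuous_mdistP (R : realType) (Y : metricType R) (f : Y -> R) :
  unif_continuous f <-> forall e, 0 < e -> exists2 d, 0 < d &
    forall y z, mdist y z < d -> `|f y - f z| < e.
Proof.
split=> [/unif_continuousP fu e e0|fu].
  have [d d0 fd] := fu e e0; exists d => // y z yz.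
  by have := fd (y, z); rewrite -ball_normE ballEmdist; exact.
apply/unif_continuousP => e e0; have [d d0 fd] := fu e e0.
exists d => // -[y z]; rewrite -ball_normE ballEmdist; exact: fd.
Qed.

Lemma unif_continuous_mdist_continuous (R : realType) (Y : metricType R) (f : Y -> R) :
  unif_continuous f -> continuous f.
Proof.
move=> /unif_continuous_mdistP fu y; apply/cvgrPdist_lt => e e0.
have [d d0 fd] := fu e e0.
by apply/metricType_numDomainType.nbhs_mdistP; exists d => // z; exact: fd.
Qed.

Section orbit_pseudometric.
Context {R : realType} {X : metricType R} {G : groupClosed (Iso X)}.
Local Notation H := (subgroup_type G).

Definition orbit_dist n (x : 'rV[X]_n) (g h : H) : R :=
  mdist (row_act g x) (row_act h x).

Lemma orbit_dist_pseudometric n (x : 'rV[X]_n) : left_pseudometric (orbit_dist x).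
Proof.
split=> [g|g h|g h k|k g h|e e0]; rewrite /orbit_dist.
- exact: mdistxx.
- exact: metric_sym.
- exact: metric_triangle.
- by rewrite !row_actM row_act_mdist.
- exact: row_act_mdist_lt.
Qed.

(** Concatenating tuples makes the family of orbit pseudometrics directed. *)
Lemma orbit_dist_row_mx n p (x : 'rV[X]_n) (y : 'rV[X]_p) (g h : H) :
  orbit_dist x g h <= orbit_dist (row_mx x y) g h /\
  orbit_dist y g h <= orbit_dist (row_mx x y) g h.
Proof.
split; apply: bigmax_le; rewrite ?mdist_ge0// => i _.
- have := le_bigmax 0 (fun i => mdist (row_act g (row_mx x y) ord0 i)
    (row_act h (row_mx x y) ord0 i)) (lshift p i).
  apply: le_trans; rewrite !mxE; case: splitP => [j /= /ord_inj <-//|j /= ij].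
  by have := ltn_ord i; rewrite ij ltnNge leq_addr.
- have := le_bigmax 0 (fun i => mdist (row_act g (row_mx x y) ord0 i)
    (row_act h (row_mx x y) ord0 i)) (rshift n i).
  apply: le_trans; rewrite !mxE; case: splitP => [j /= ji|j /= ij]; last first.
    by have <- : i = j by apply/ord_inj/(@addnI n).
  by have := ltn_ord j; rewrite -ji ltnNge leq_addr.
Qed.

Lemma nbhs_initialE (S : choiceType) (T : topologicalType) (f : S -> T)
    (s : initial_topology f) (U : set S) :
  nbhs s U -> exists2 B : set T, nbhs (f s) B & f @^-1` B `<=` U.
Proof.
move=> [_ [[B oB <-] Bs] BU]; exists B => //.
by apply: open_nbhs_nbhs; split.
Qed.

Lemma row0 : 'rV[X]_0.
Proof. by apply: matrix_of_fun tt _ => _ []. Qed.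

(** Along the filter generated by the orbit balls around 1, group elements converge pointwise to the
    identity, each point being controlled by a 1-tuple. So this filter refines the neighbourhoods of
    1. *)
Lemma nbhs1_orbit_dist (U : set H) : nbhs 1%g U ->
  exists i : {n & 'rV[X]_n}, exists2 r, 0 < r &
    forall g, orbit_dist (projT2 i) 1%g g < r -> U g.
Proof.
move=> /nbhs_initialE[V V1 VU].
have [W W1 WV] : exists2 W : set {ptws X -> X}, nbhs (id : {ptws X -> X}) W &
    set_val @^-1` W `<=` V.
  exact: (nbhs_initialE V1).
pose F : set_system H := filter_from [set q : {n & 'rV[X]_n} * R | 0 < q.2]
  (fun q => [set g | orbit_dist (projT2 q.1) 1%g g < q.2]).
have FF : Filter F.
  apply: filter_from_filter; first by exists (existT _ 0%N row0, 1) => /=.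
  move=> [[n x] r] [[p y] s] /= r0 s0.
  exists (existT _ (n + p)%N (row_mx x y), Num.min r s); first by rewrite /= lt_min r0.
  move=> g /=; rewrite lt_min => /andP[gr gs].
  have [gx gy] := orbit_dist_row_mx x y 1%g g.
  by split; [exact: le_lt_trans gx gr|exact: le_lt_trans gy gs].
pose ev (g : H) : {ptws X -> X} := Iso_fun (val g).
have : {ptws, (ev @ F) --> (id : {ptws X -> X})}.
  apply/pointwise_cvgP => t; apply/metricType_numDomainType.cvgrPdist_lt => e e0.
  exists (existT _ 1%N (const_mx t), e) => // g /=.
  apply: le_lt_trans.
  have := le_bigmax 0 (fun i => mdist (row_act (1%g : H) (const_mx t : 'rV[X]_1) ord0 i)
    (row_act g (const_mx t) ord0 i)) ord0.
  by rewrite !mxE.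
move=> /(_ W W1)[[i r] /= r0 irW]; exists i, r => // g gr.
by apply: VU; apply: WV; exact: (irW g gr).
Qed.

(** For each tolerance and each finite list of pairs from the countable dense set, one group element
    is chosen that moves first entries close to second ones, if any does. Such requests are
    countably many. *)
Lemma separable_subgroup : separable X -> exists d : nat -> H, dense (range d).
Proof.
move=> [D [/countable_injP[c c_inj] dD]].
pose near_by (q : nat * seq (nat * nat)) (h : H) := forall p, p \in q.2 ->
  exists a b, [/\ D a, D b, c a = p.1 /\ c b = p.2 &
    mdist (Iso_fun (val h) a) b < q.1.+1%:R^-1].
have /choice[h hP] : forall q, exists h, (exists h', near_by q h') -> near_by q h.
  by move=> q; have [[h' h'q]|nq] := pselect (exists h', near_by q h');
    [exists h'|exists 1%g].
(* Numbers that encode no request are sent to [1%g]. *)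
exists (fun n => oapp h 1%g (choice.unpickle n)) => U [g Ug] oU.
have [[n x] [r r0 /= rU]] : exists i : {n & 'rV[X]_n}, exists2 r, 0 < r &
    forall k, orbit_dist (projT2 i) 1%g k < r -> U (g * k)%g.
  apply: (@nbhs1_orbit_dist [set k | U (g * k)%g]).
  have -> : [set k | U (g * k)%g] = (fun k => U (g * k * 1)%g).
    by apply/funext => k /=; rewrite mulg1.
  apply: (@mulg2_continuous H g 1%g 1%g) => /=; rewrite !mulg1.
  exact: open_nbhs_nbhs (conj oU Ug).
(* The path from [g x] to [h x] runs through [g a], [b] and [h a], in four steps shorter than
   [r / 4]. *)
have r40 : 0 < r / 4 by rewrite divr_gt0.
pose k := Num.truncn (r / 4)^-1.
have kr : k.+1%:R^-1 < r / 4.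
  by rewrite invf_plt ?posrE// truncnS_gt.
have /choice[a aP] : forall i, exists a, D a /\ mdist (x ord0 i) a < r / 4.
  by move=> i; have [a Da xa] := dense_mdist (x ord0 i) dD r40; exists a.
have /choice[b bP] : forall i, exists b, D b /\
    mdist (Iso_fun (val g) (a i)) b < k.+1%:R^-1.
  move=> i; have [|b Db ab] := dense_mdist (e := k.+1%:R^-1) (Iso_fun (val g) (a i)) dD.
    by rewrite invr_gt0.
  by exists b.
pose q := (k, [seq (c (a i), c (b i)) | i <- enum 'I_n]).
exists (h q); split; last by exists (choice.pickle q) => //; rewrite choice.pickleK.
have hq : near_by q (h q).
  apply: hP; exists g => _ /mapP[i _ ->]; exists (a i), (b i).
  by have [? ?] := aP i; have [? ?] := bP i.
have -> : h q = (g * (g^-1 * h q))%g by rewrite mulVKg.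
apply: rU; rewrite -(pdist_left (orbit_dist_pseudometric x) g) mulg1 mulVKg.
apply: bigmax_lt => // i _; rewrite !mxE.
have [a' [b' [Da' Db' /= [ca cb] hab]]] : exists a' b', [/\ D a', D b',
    c a' = c (a i) /\ c b' = c (b i) & mdist (Iso_fun (val (h q)) a') b' < k.+1%:R^-1].
  have [|a' [b' ?]] := hq (c (a i), c (b i)); last by exists a', b'.
  by apply/mapP; exists i => //; rewrite mem_enum.
have [Da xa] := aP i; have [Db gab] := bP i.
have ea : a' = a i by apply: c_inj => //; exact: mem_set.
have eb : b' = b i by apply: c_inj => //; exact: mem_set.
rewrite {}ea {}eb in hab.
have h1 := metric_triangle (Iso_fun (val g) (x ord0 i)) (Iso_fun (val g) (a i))
  (Iso_fun (val (h q)) (x ord0 i)).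
have h2 := metric_triangle (Iso_fun (val g) (a i)) (b i)
  (Iso_fun (val (h q)) (x ord0 i)).
have h3 := metric_triangle (b i) (Iso_fun (val (h q)) (a i))
  (Iso_fun (val (h q)) (x ord0 i)).
rewrite !Iso_mdist in h1 h3.
rewrite (metric_sym (b i) (Iso_fun (val (h q)) (a i))) (metric_sym (a i)) in h3.
have {}hab : mdist (Iso_fun (val (h q)) (a i)) (b i) < k.+1%:R^-1 := hab.
apply: le_lt_trans h1 _; move: h2 h3 xa (lt_trans gab kr) (lt_trans hab kr); lra.
Qed.

(** * Transfer between an orbit and the group *)

Section orbit_liouville.
Variables (n : nat) (x : 'rV[X]_n) (mu : probability (borelType H) R).

Let row_orbit_base : row_orbit G x x.
Proof. by exists 1%g => //; exact: row_act1. Qed.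

Let base : row_orbit G x := exist (fun z => z \in row_orbit G x) x (mem_set row_orbit_base).

Let orbit_surj (y : row_orbit G x) : exists g, y = orbit_act g base.
Proof.
have [g _ gy] := set_mem (valP y); exists g.
by apply: val_inj; rewrite /= -gy.
Qed.

(** A harmonic function on the orbit is pulled back along the orbit map [g |-> g x]. *)
Lemma mu_liouville_orbit :
  (forall (f : H -> R) (M : R), rho_unif_continuous (orbit_dist x) f ->
     (forall g, `|f g| <= M) ->
     (forall w, (\int[mu]_h (f (h * w)%g)%:E)%E = (f w)%:E) ->
     forall g h, f g = f h) ->
  mu_liouville (orbit_action G x) mu.
Proof.
move=> muL f [_ _ fh] fu [M fM].
exists (f base) => y; have [g ->] := orbit_surj y.
have -> : f base = f (orbit_act 1%g base) by rewrite orbit_act1.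
apply: (muL (fun g => f (orbit_act g base)) M) => // [e e0|w].
  have /unif_continuous_mdistP/(_ _ e0)[d d0 fd] := fu.
  by exists d => // g' h gh; apply/ltW/fd.
by rewrite fh; apply: eq_integral => h _; rewrite /= orbit_actM.
Qed.

(** A Lipschitz function for [orbit_dist x] takes equal values at [g] and [h] when [g x = h x], so
    it descends to a Lipschitz function on the orbit. *)
Lemma lip_orbit_liouville : mu_liouville (orbit_action G x) mu ->
  forall (f : H -> R) (L M : R), lip (orbit_dist x) L f -> (forall g, `|f g| <= M) ->
    (forall w, (f w)%:E = (\int[mu]_h (f (h * w)%g)%:E)%E) ->
    exists c, forall g, f g = c.
Proof.
move=> muL f L M fL fM fh.
(* A section of the orbit map. *)
have /choice[r rP] := orbit_surj.
pose F y := f (r y).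
have fF g : F (orbit_act g base) = f g.
  apply/eqP; rewrite -subr_eq0 -normr_le0; apply: le_trans (fL _ _) _.
  have := congr1 val (rP (orbit_act g base)); rewrite /= /orbit_dist => <-.
  by rewrite mdistxx mulr0.
have FL y z : `|F y - F z| <= L * mdist y z.
  apply: le_trans (fL _ _) _; rewrite le_eqVlt; apply/orP; left; apply/eqP.
  by rewrite [in RHS](rP y) [in RHS](rP z).
have Fu : unif_continuous F.
  apply/unif_continuous_mdistP => e e0; have L0 : 0 < `|L| + 1 by rewrite ltr_wpDl.
  exists (e / (`|L| + 1)); first by rewrite divr_gt0.
  move=> y z; rewrite ltr_pdivlMr// => yz.
  apply: le_lt_trans (FL y z) _; apply: le_lt_trans yz; rewrite mulrC.
  by rewrite ler_wpM2l ?mdist_ge0//; have := ler_norm L; lra.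
have Fb : bounded F by exists M => y; exact: fM.
have [|c Fc] := muL F _ Fu Fb; last by exists c => g; rewrite -fF.
split=> // [B mB|y].
  exact: continuous_preimage_borel (unif_continuous_mdist_continuous Fu) mB.
have [g ->] := orbit_surj y; rewrite fF fh; apply: eq_integral => h _.
by rewrite /= -orbit_actM fF.
Qed.

End orbit_liouville.

End orbit_pseudometric.

Theorem theorem5p8 (R : realType) (X : metricType R)
  (X_separable : separable X) (G : groupClosed (Iso X)) :
  amenable R (subgroup_type G) <->
  forall (n : nat) (x : 'rV[X]_n), liouville (orbit_action G x).
Proof.
have [d dd] := @separable_subgroup R X G X_separable.
split=> [amG n x|liouvilleG].
  have [mu [mu_nd mu_reg muL]] :=
    amenable_liouville_measure amG (orbit_dist_pseudometric x) dd.
  by exists mu; split=> //; exact: mu_liouville_orbit.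
apply: (@amenable_of_liouville R (subgroup_type G) {n & 'rV[X]_n}
  (fun i => orbit_dist (projT2 i)) d (existT _ 0%N row0) dd) => [[n x]|[n x] [p y]|U U1|[n x]].
- exact: orbit_dist_pseudometric.
- by exists (existT _ (n + p)%N (row_mx x y)) => g h /=; exact: orbit_dist_row_mx.
- exact: nbhs1_orbit_dist.
- have [mu [_ _ muL]] := liouvilleG n x.
  by exists mu => f L M; exact: lip_orbit_liouville.
Qed.
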